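(* Let $X$ be a nonsingular affine variety, locally closed in $\mathbb{P}^r$, of dimension $n\ge 1$, let $x\in X$ be a point, and let $s_1,\dots,s_n\in\mathcal{O}_X$ be such that $\{ds_i\}$ is a basis of $\Omega^1_X$. Let $\{T_0,\dots,T_r\}$ be a basis of $V$ and let $U\subseteq\mathbb{P}^r$ be an affine open subset containing $X$ as a closed subvariety with ideal $I_X\subseteq\mathcal{O}_U$, such that $t_0=T_0|_U$ trivializes $\mathcal{O}_U(1)=\mathcal{O}_U\cdot t_0$ and $T_i|_U=t_it_0$ with $t_i\in\mathcal{O}_U$ ($1\le i\le r$) such that $\{dt_1,\dots,dt_r\}$ is a basis of $\Omega^1_{\mathbb{P}^r}|_U$. Write $\bar t_i$ for the restriction of $t_i$ to $\mathcal{O}_X$, $\bar t_0$ for the restriction of $t_0$ to $L$, and $\frac{\overline{\partial f}}{\partial t_i}$ for the restriction of $\frac{\partial f}{\partial t_i}$ to $\mathcal{O}_X$. Let $k\ge 2$. For $\bar f\in N^*_X=I_X/I_X^2$ represented by $f\in I_X$: (1) The following are equivalent: $\bar f\in R_{k-1}$; $\alpha_{k-1}(\bar f\otimes\bar t_0)=0$; $\mathbf{F}^*_j(\bar f)=0$ for $1\le j\le k-1$ (where, successively, the vanishing of $\mathbf{F}_1^*(\bar f),\dots,\mathbf{F}^*_{j-1}(\bar f)$ ensures that $\bar f\in R_{j-1}$, so that $\mathbf{F}^*_j(\bar f)$ is defined). (2) The $k$-th fundamental form $\mathbf{F}^*_k:R_{k-1}\to S^k\Omega^1_X$ has the local form $$\mathbf{F}^*_k(\bar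 f)=\sum_{i=1}^r\frac{\overline{\partial f}}{\partial t_i}\Big(\sum_{|\mathbf{p}|=k}D_{\mathbf{p}}(\bar t_i)\,ds^{\mathbf{p}}\Big),\quad\bar f\in R_{k-1},$$ which does not depend on the choice of the trivialization $L=\mathcal{O}_X\cdot\bar t_0$ of $L$ given by the restriction $\bar t_0$ of $T_0$ (with the corresponding functions $t_i$ determined by $T_i|_U=t_it_0$, $1\le i\le r$). (3) The fundamental form $\mathbf{F}^*_{k,x}:R_{k-1}\otimes k(x)\to S^k\Omega^1_x(X)$ obtained by tensoring with the residue field $k(x)$ is $$\mathbf{F}^*_{k,x}(\bar f\otimes 1)=\sum_{i=1}^r\frac{\overline{\partial f}}{\partial t_i}(x)\Big(\sum_{|\mathbf{p}|=k}D_{\mathbf{p},x}(\bar t_i)\,S^{\mathbf{p}}\Big),\quad \bar f\in R_{k-1},$$ where $\frac{\overline{\partial f}}{\partial t_i}(x)$ and $D_{\mathbf{p},x}(\bar t_i)$ are the values at $x$ of $\frac{\overline{\partial f}}{\partial t_i}$ and $D_{\mathbf{p}}(\bar t_i)$, and $S^{\mathbf{p}}=S_1^{p_1}\cdots S_n^{p_n}$ with $S_i=ds_i\otimes 1$.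
   Context: Work over $\mathbb{C}$. Let $L=\mathcal{O}_X(1)$, $V=H^0(\mathbb{P}^r,\mathcal{O}_{\mathbb{P}^r}(1))$. For $k\ge 0$ let $P^k(L)=pr_{1,*}\big((\mathcal{O}_{X\times X}/I_\Delta^{k+1})\otimes pr_2^*L\big)$ be the sheaf of $k$-th order principal parts ($\mathcal{O}_X$-module via $pr_1$), $P^k_X=P^k(\mathcal{O}_X)$, with universal differential operators $d^k_L:L\to P^k(L)$ and $d^k:\mathcal{O}_X\to P^k_X$ induced by $pr_2$. The Taylor series map is $\alpha_k:V\otimes\mathcal{O}_X\to P^k(L)$, $T\otimes a\mapsto a\,d^k_L(T|_X)$; $R_k=(\ker\alpha_k)\otimes L^*$. In $P^k_X$ put $ds_i=d^ks_i-s_i$ and, for a multi-index $\mathbf{p}=(p_1,\dots,p_n)$, $ds^{\mathbf{p}}=ds_1^{p_1}\cdots ds_n^{p_n}$; then $\{ds^{\mathbf{p}}:|\mathbf{p}|\le k\}$ is an $\mathcal{O}_X$-basis of $P^k_X$, and $\{D_{\mathbf{p}}\}$ denotes the dual basis of differential operators, so $d^k(e)=\sum_{|\mathbf{p}|\le k}D_{\mathbf{p}}(e)ds^{\mathbf{p}}$. Since $X$ is nonsingular, $R_0=\Omega^1_{\mathbb{P}^r}|_X$ and $R_1=N_X^*$, and all $R_k$ with $k\ge 1$ are subsheaves of $N_X^*\subseteq\Omega^1_{\mathbb{P}^r}|_X$. The inclusion $N^*_X\otimes L=R_1\otimes L\hookrightarrow V\otimes\mathcal{O}_X$ sends $\bar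 f\otimes\bar t_0$ to $\sum_{i=1}^r\frac{\overline{\partial f}}{\partial t_i}(T_i\otimes 1-T_0\otimes\bar t_i)$; via it $\alpha_k$ is regarded as a map on $N_X^*\otimes L$. The kernel of the truncation $P^k(L)\to P^{k-1}(L)$ is $S^k\Omega^1_X\otimes L$ (via $ds^{\mathbf{p}}\otimes\bar t_0\mapsto ds^{\mathbf{p}}d^k_L(\bar t_0)$), $\alpha_k$ restricted to $R_{k-1}\otimes L$ lands in it, and twisting by $L^*$ gives the $k$-th fundamental form $\mathbf{F}^*_k:R_{k-1}\to S^k\Omega^1_X$ for $k\ge 1$. *)

(* Defs.v *)
From HB Require Import structures.
From mathcomp Require Import all_boot all_order all_algebra perm.
From mathcomp Require Import all_classical.
From mathcomp Require Import mpoly.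

Set Implicit Arguments.
Unset Strict Implicit.
Unset Printing Implicit Defensive.

Import GRing.Theory.
Local Open Scope classical_set_scope.
Local Open Scope ring_scope.
Local Open Scope quotient_scope.

Section Bases.
Variables (B : comPzRingType) (M : lmodType B) (I : finType).

Definition is_basis (e : I -> M) : Prop :=
  forall v : M, exists! c : {ffun I -> B}, v = \sum_i c i *: e i.

(* The coordinate functions of [e]; they form the dual basis when [e] is a
   basis, and are unspecified on vectors outside the span of [e]. *)
Definition coord (e : I -> M) (v : M) : I -> B :=
  xget (fun=> 0) [set c : I -> B | v = \sum_i c i *: e i].

End Bases.

Section Span.
Variables (B : comPzRingType) (M : lmodType B).

Definition span (S : set M) : {pred M} :=
  [pred v | `[< forall N : submodClosed M, (forall u, S u -> u \in N) -> v \in N >]].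

Lemma span_submod_closed (S : set M) : submod_closed (span S).
Proof.
split=> [|a u v /asboolP hu /asboolP hv]; apply/asboolP => N hN.
  exact: rpred0.
by rewrite rpredD ?rpredZ ?hu ?hv.
Qed.

HB.instance Definition _ (S : set M) :=
  GRing.isSubmodClosed.Build B M (span S) (span_submod_closed S).

End Span.

Section Submodule.
Variables (B : comPzRingType) (M : lmodType B) (S : submodClosed M).

Definition submod := {v : M | v \in S}.

HB.instance Definition _ := SubChoice.on submod.
HB.instance Definition _ := [SubChoice_isSubLmodule of submod by <:].

(* [submodClosed] does not inherit from [zmodClosed] in the library. *)
Definition carrier : {pred M} := S.

Lemma carrier_zmod_closed : zmod_closed carrier.
Proof. exact: (GRing.submod_closedB (submodClosedP S)). Qed.

HB.instance Definition _ := GRing.isZmodClosed.Build M carrier carrier_zmod_closed.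

Definition quotmod := Quotient.quot carrier.

HB.instance Definition _ := GRing.Zmodule.on quotmod.
HB.instance Definition _ := EqQuotient.on quotmod.

Definition coset (u : M) : quotmod := \pi_quotmod u.
Definition rep (v : quotmod) : M := repr v.

Lemma repK : cancel rep coset. Proof. exact: reprK. Qed.

Lemma coset_eqP (u v : M) : reflect (coset u = coset v) (u - v \in S).
Proof.
rewrite -[_ \in S]/(_ \in carrier) (Quotient.idealrBE carrier).
exact: (iffP eqP).
Qed.

Lemma cosetD : {morph coset : u v / u + v}.
Proof. exact: (raddfD \pi_quotmod). Qed.

Definition quot_scale (a : B) (v : quotmod) : quotmod := coset (a *: rep v).

Lemma quot_scaleE a u : quot_scale a (coset u) = coset (a *: u).
Proof.
apply/coset_eqP; rewrite -scalerBr; apply: rpredZ.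
by apply/coset_eqP; rewrite repK.
Qed.

Lemma quot_scaleA a b v : quot_scale a (quot_scale b v) = quot_scale (a * b) v.
Proof. by rewrite -[v]repK !quot_scaleE scalerA. Qed.

Lemma quot_scale1 : left_id 1 quot_scale.
Proof. by move=> v; rewrite -[v]repK quot_scaleE scale1r. Qed.

Lemma quot_scaleDr : right_distributive quot_scale +%R.
Proof.
move=> a u v; rewrite -[u]repK -[v]repK.
by rewrite -cosetD !quot_scaleE -cosetD scalerDr.
Qed.

Lemma quot_scaleDl v : {morph quot_scale^~ v : a b / a + b}.
Proof.
by move=> a b /=; rewrite -[v]repK !quot_scaleE -cosetD scalerDl.
Qed.

HB.instance Definition _ := GRing.Zmodule_isLmodule.Build B quotmod
  quot_scaleA quot_scale1 quot_scaleDr quot_scaleDl.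

Lemma coset_linear : linear coset.
Proof. by move=> a u v; rewrite cosetD -quot_scaleE. Qed.

HB.instance Definition _ := GRing.isLinear.Build B M quotmod *:%R coset
  coset_linear.

End Submodule.

(* M / (M \cap N) for two submodules M and N of E; it is M / N if N <= M. *)
Section Subquotient.
Variables (B : comPzRingType) (E : lmodType B) (M N : submodClosed E).

Definition sub_pred : {pred submod M} := [pred u | val u \in N].

Lemma sub_pred_closed : submod_closed sub_pred.
Proof.
split=> [|a u v]; rewrite !inE ?raddf0 ?rpred0// => hu hv.
by rewrite linearP rpredD ?rpredZ.
Qed.

HB.instance Definition _ :=
  GRing.isSubmodClosed.Build B (submod M) sub_pred sub_pred_closed.

Definition subquot := quotmod sub_pred.

HB.instance Definition _ := GRing.Lmodule.on subquot.

(* Only meaningful for u in M. *)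
Definition cls (u : E) : subquot := coset sub_pred (insubd 0 u).
Definition subrep (v : subquot) : E := val (rep v).

End Subquotient.

Section SymmetricPower.
Variables (B : comPzRingType) (k : nat) (Q : lmodType B).
Implicit Types w : {ffun 'I_k -> Q}.

Definition slot w (j : 'I_k) (v : Q) : {ffun 'I_k -> Q} :=
  [ffun i => if i == j then v else w i].

Definition delta w : {ffun 'I_k -> Q} -> B^o := fun w' => (w' == w)%:R.

Definition sym_gens : set ({ffun 'I_k -> Q} -> B^o) := range delta.

Definition sym_rels : set ({ffun 'I_k -> Q} -> B^o) :=
  [set g | (exists w j a u v,
              g = delta (slot w j (a *: u + v))
                  - a *: delta (slot w j u) - delta (slot w j v))
        \/ (exists w (s : 'S_k), g = delta [ffun j => w (s j)] - delta w)].

(* The free module on Q^k, realised as the span of the [delta w] inside the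
   module of all functions on Q^k, modulo multilinearity and symmetry. *)
Definition Sym := subquot (span sym_gens) (span sym_rels).

HB.instance Definition _ := GRing.Lmodule.on Sym.

Definition symprod w : Sym := cls (span sym_gens) (span sym_rels) (delta w).

Definition sym_monomial n (e : 'I_n -> Q) (p : 'X_{1..n}) : Sym :=
  symprod [ffun j : 'I_k => nth 0 [seq e i | i <- m2s p] j].

(* The map induced by a symmetric multilinear [phi]; [h] is the ring morphism
   along which it is semilinear. The sum is finite: a representative is
   supported on finitely many tuples. *)
Definition sym_lift (B' : comPzRingType) (Z : lmodType B') (h : B -> B')
    (phi : {ffun 'I_k -> Q} -> Z) (v : Sym) : Z :=
  \sum_(w \in [set: {ffun 'I_k -> Q}]) h (subrep v w) *: phi w.

End SymmetricPower.

Section ProjectiveSpace.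
Variables (F : fieldType) (r : nat).

(* A subset of P^r is represented by its cone: a set of nonzero vectors of
   F^(r+1) stable under nonzero scalars. *)
Local Notation pt := 'rV[F]_r.+1.
Implicit Types X Y Z W : set pt.

Definition proj_zeros (S : set {mpoly F[r.+1]}) : set pt :=
  [set x | x != 0 /\ forall p, S p -> p.@[x 0] = 0].

Definition proj_closed Z : Prop :=
  exists2 S : set {mpoly F[r.+1]},
    (forall p, S p -> exists d : nat, p \is d.-homog) & Z = proj_zeros S.

Definition proj_open W : Prop :=
  exists2 Z, proj_closed Z & W = [set x | x != 0] `\` Z.

Definition closed_in X Y : Prop := exists2 Z, proj_closed Z & X = Y `&` Z.

Definition locally_closed X : Prop := exists2 W, proj_open W & closed_in X W.

Definition irreducible_set X : Prop :=
  X !=set0 /\ forall Z1 Z2, proj_closed Z1 -> proj_closed Z2 ->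
    X `<=` Z1 `|` Z2 -> X `<=` Z1 \/ X `<=` Z2.

Definition has_chain X (m : nat) : Prop :=
  exists Z : nat -> set pt,
    (forall i, (i <= m)%N -> irreducible_set (Z i) /\ closed_in (Z i) X) /\
    (forall i, (i < m)%N -> Z i `<` Z i.+1).

Definition has_dim X (n : nat) : Prop := has_chain X n /\ ~ has_chain X n.+1.

(* Sections of O(d) over X are functions on the cone that are locally quotients
   of homogeneous polynomials with degrees differing by d. The test on [val x]
   is vacuous on cones and makes the sections a group for every X. *)
Definition is_section (d : int) X (f : X -> F) : Prop :=
  forall x : X, val x != 0 -> exists (m e : nat) (p q : {mpoly F[r.+1]}),
    [/\ p \is m.-homog, q \is e.-homog, m%:Z = e%:Z + d,
        q.@[val x 0] != 0 &
        forall y : X, q.@[val y 0] != 0 -> f y = p.@[val y 0] / q.@[val y 0]].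

Arguments is_section d X f : clear implicits.

Definition section_pred (d : int) X : {pred X -> F} :=
  [pred f | `[< is_section d X f >]].

Arguments section_pred d X : clear implicits.

Lemma section_predP d X (f : X -> F) :
  reflect (is_section d X f) (f \in section_pred d X).
Proof. exact: asboolP. Qed.

Lemma is_section_cst X (c : F) : is_section 0 X (fun=> c).
Proof.
move=> x _; exists 0%N, 0%N, (c *: 1), 1; split=> //.
- by apply: dhomogZ; exact: dhomog1.
- exact: dhomog1.
- by rewrite meval1 oner_eq0.
- by move=> y _; rewrite mevalZ meval1 divr1 mulr1.
Qed.

Lemma is_sectionM d e X (f g : X -> F) :
  is_section d X f -> is_section e X g -> is_section (d + e) X (f * g).
Proof.
move=> hf hg x x0; have [a [b [p [q [hp hq hab qx Ef]]]]] := hf x x0.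
have [a' [b' [p' [q' [hp' hq' hab' qx' Eg]]]]] := hg x x0.
exists (a + a')%N, (b + b')%N, (p * p'), (q * q'); split.
- exact: dhomogM.
- exact: dhomogM.
- by rewrite !PoszD hab hab' addrACA.
- by rewrite mevalM mulf_neq0.
- move=> y; rewrite !mevalM mulf_eq0 negb_or => /andP[qy qy'].
  by rewrite -mulf_div -Ef// -Eg.
Qed.

Lemma is_section_submod d X (c : F) (f g : X -> F) :
  is_section d X f -> is_section d X g -> is_section d X (fun x => c * f x + g x).
Proof.
move=> hf hg x x0; have [a [b [p [q [hp hq hab qx Ef]]]]] := hf x x0.
have [a' [b' [p' [q' [hp' hq' hab' qx' Eg]]]]] := hg x x0.
have aE : (b + a' = a + b')%N.
  by apply/eqP; rewrite -eqz_nat !PoszD hab hab' addrA addrAC.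
exists (a + b')%N, (b + b')%N, (c *: (p * q') + q * p'), (q * q'); split.
- by apply: dhomogD; [apply: dhomogZ; exact: dhomogM | rewrite -aE; exact: dhomogM].
- exact: dhomogM.
- by rewrite !PoszD hab addrAC.
- by rewrite mevalM mulf_neq0.
- move=> y; rewrite mevalD mevalZ !mevalM mulf_eq0 negb_or => /andP[qy qy'].
  rewrite Ef// Eg// mulrA addf_div//; congr (_ / _).
  by rewrite -!mulrA; congr (_ + _); rewrite mulrC.
Qed.

Lemma is_section0 d X : is_section d X 0.
Proof.
move=> x x0; have [j xj] : exists j, val x 0 j != 0.
  exact/rV0Pn.
case: d => n.
  exists n, 0%N, 0, 1; split; rewrite ?dhomog0 ?dhomog1 ?add0r ?meval1 ?oner_eq0//.
  by move=> y _; rewrite meval0 mul0r.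
exists 0%N, n.+1, 0, ('X_j ^+ n.+1); split; rewrite ?dhomog0//.
- by rewrite -[X in X.-homog]mul1n; apply: dhomogMn; rewrite dhomogX; apply/eqP/mdeg1.
- by rewrite NegzE addrN.
- by rewrite rmorphXn/= mevalXU expf_neq0.
- by move=> y _; rewrite meval0 mul0r.
Qed.

Lemma section_zmod_closed d X : zmod_closed (section_pred d X).
Proof.
split=> [|f g /section_predP hf /section_predP hg]; apply/section_predP.
  exact: is_section0.
rewrite (_ : f - g = fun x => -1 * g x + f x); first exact: is_section_submod.
by apply/funext => x /=; rewrite mulN1r addrC.
Qed.

HB.instance Definition _ d X :=
  GRing.isZmodClosed.Build (X -> F) (section_pred d X) (section_zmod_closed d X).

Definition sect (d : int) X := {f : X -> F | f \in section_pred d X}.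

HB.instance Definition _ d X := SubChoice.on (sect d X).
HB.instance Definition _ d X := [SubChoice_isSubZmodule of sect d X by <:].

Definition reg_pred X : {pred X -> F} := section_pred 0 X.

Arguments reg_pred X : clear implicits.

Lemma reg_subring_closed X : subring_closed (reg_pred X).
Proof.
split=> [|f g|f g /section_predP hf /section_predP hg].
- by apply/section_predP; exact: is_section_cst.
- exact: (rpredB (S := section_pred 0 X)).
- by apply/section_predP; rewrite -[X in is_section X]addr0; exact: is_sectionM.
Qed.

HB.instance Definition _ X :=
  GRing.isSubringClosed.Build (X -> F) (reg_pred X) (@reg_subring_closed X).

Definition reg X := {f : X -> F | f \in reg_pred X}.

HB.instance Definition _ X := SubChoice.on (reg X).
HB.instance Definition _ X := GRing.SubChoice_isSubComPzRing.Build
  (X -> F) (reg_pred X) (reg X) (@reg_subring_closed X).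

Definition ev X (x : X) (a : reg X) : F := val a x.

Definition cst_reg X (c : F) : reg X :=
  exist (fun f => f \in reg_pred X) (fun=> c)
    (introT (section_predP _ _) (@is_section_cst X c)).

Lemma sect_scale_subproof d X (a : reg X) (f : sect d X) :
  val a * val f \in section_pred d X.
Proof.
apply/section_predP; suff: is_section (0 + d) X (val a * val f) by rewrite add0r.
by apply: is_sectionM; apply/section_predP; exact: valP.
Qed.

Definition sect_scale d X (a : reg X) (f : sect d X) : sect d X :=
  Sub (val a * val f) (sect_scale_subproof a f).

Lemma sect_scaleA d X (a b : reg X) (f : sect d X) :
  sect_scale a (sect_scale b f) = sect_scale (a * b) f.
Proof. by apply: val_inj; rewrite /= mulrA. Qed.

Lemma sect_scale1 d X : left_id 1 (@sect_scale d X).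
Proof. by move=> f; apply: val_inj; rewrite /= mul1r. Qed.

Lemma sect_scaleDr d X : right_distributive (@sect_scale d X) +%R.
Proof. by move=> a f g; apply: val_inj; rewrite /= mulrDr. Qed.

Lemma sect_scaleDl d X (f : sect d X) :
  {morph (@sect_scale d X)^~ f : a b / a + b}.
Proof. by move=> a b; apply: val_inj; rewrite /= mulrDl. Qed.

HB.instance Definition _ d X := GRing.Zmodule_isLmodule.Build (reg X) (sect d X)
  (@sect_scaleA d X) (@sect_scale1 d X) (@sect_scaleDr d X) (@sect_scaleDl d X).

(* The pairing O(-1) x O(1) -> O. *)
Lemma pairing_subproof X (l : sect (-1) X) (m : sect 1 X) :
  val l * val m \in reg_pred X.
Proof.
apply/section_predP; rewrite -[X in is_section X](addNr (1 : int)).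
by apply: is_sectionM; apply/section_predP; exact: valP.
Qed.

Definition pairing X (l : sect (-1) X) (m : sect 1 X) : reg X :=
  Sub (val l * val m) (pairing_subproof l m).

(* V is identified with the coefficient vectors of linear forms. *)
Local Notation V := 'cV[F]_r.+1.

Lemma linform_subproof X (T : V) :
  (fun x : X => (val x *m T) 0 0) \in section_pred 1 X.
Proof.
apply/section_predP => x _.
exists 1%N, 0%N, (\sum_j T j 0 *: 'X_j), 1; split.
- by apply: rpred_sum => j _; apply: dhomogZ; rewrite dhomogX; apply/eqP/mdeg1.
- exact: dhomog1.
- by [].
- by rewrite meval1 oner_eq0.
- move=> y _; rewrite meval1 divr1 mxE raddf_sum/=.
  by apply: eq_bigr => j _; rewrite mevalZ mevalXU mulrC.
Qed.

Definition linform X (T : V) : sect 1 X :=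
  exist (fun f => f \in section_pred 1 X) _ (linform_subproof X T).

(* [Y] is isomorphic to a Zariski-closed subset [A] of some affine space: the
   isomorphism is [phi], with regular coordinates, and its inverse is locally
   z |-> [q_0(z) : ... : q_r(z)]. *)
Definition affine_set Y : Prop :=
  exists (m : nat) (S : set {mpoly F[m]}) (phi : 'I_m -> reg Y),
    let A := [set z : 'I_m -> F | forall p, S p -> p.@[z] = 0] in
    let q_at (q : 'I_r.+1 -> {mpoly F[m]}) z : pt := \row_j (q j).@[z] in
    (forall y : Y, A (fun i => ev y (phi i))) /\
    (forall z0, A z0 -> exists q : 'I_r.+1 -> {mpoly F[m]}, q_at q z0 != 0 /\
       forall z, A z -> q_at q z != 0 -> forall y : pt,
         (exists h : y \in Y, (fun i => ev (exist _ y h) (phi i)) = z) <->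
         (exists2 c : F, c != 0 & y = c *: q_at q z)).

Section Fibers.
Variables (X : set pt) (x : X) (M : lmodType (reg X)).

(* M (x) k(x) = M / m_x M, a vector space over k(x) = F. *)
Definition max_smul : {pred M} :=
  span [set v | exists (a : reg X) (u : M), ev x a = 0 /\ v = a *: u].

HB.instance Definition _ := GRing.SubmodClosed.on max_smul.

Definition fiber := quotmod max_smul.

HB.instance Definition _ := GRing.Zmodule.on fiber.

Definition fiber_cls (u : M) : fiber := coset max_smul u.
Definition fiber_rep (v : fiber) : M := rep v.

Definition fiber_scale (c : F) (v : fiber) : fiber :=
  (cst_reg X c *: (v : quotmod max_smul))%R.

Lemma fiber_scaleA a b v : fiber_scale a (fiber_scale b v) = fiber_scale (a * b) v.
Proof.
rewrite /fiber_scale scalerA; congr (_ *: _); exact: val_inj.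
Qed.

Lemma fiber_scale1 : left_id 1 fiber_scale.
Proof.
move=> v; rewrite /fiber_scale (_ : cst_reg X 1 = 1) ?scale1r//.
exact: val_inj.
Qed.

Lemma fiber_scaleDr : right_distributive fiber_scale +%R.
Proof. by move=> a u v; rewrite /fiber_scale -scalerDr. Qed.

Lemma fiber_scaleDl v : {morph fiber_scale^~ v : a b / a + b}.
Proof.
move=> a b; rewrite /fiber_scale -scalerDl; congr (_ *: _); exact: val_inj.
Qed.

HB.instance Definition _ := GRing.Zmodule_isLmodule.Build F fiber
  fiber_scaleA fiber_scale1 fiber_scaleDr fiber_scaleDl.

End Fibers.

Section Smooth.
Variable X : set pt.

Definition max_ideal (x : X) : {pred (reg X)^o} := [pred a : reg X | ev x a == 0].

Lemma max_ideal_closed (x : X) : submod_closed (max_ideal x).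
Proof.
split=> [|a u v]; first by rewrite inE.
rewrite !inE => /eqP hu /eqP hv.
suff -> : ev x (a *: u + v) = ev x a * ev x u + ev x v by rewrite hu hv mulr0 addr0.
by [].
Qed.

HB.instance Definition _ x :=
  GRing.isSubmodClosed.Build (reg X) (reg X)^o (max_ideal x) (max_ideal_closed x).

(* For X affine of pure dimension n: the Zariski cotangent space m_x / m_x^2
   has dimension n at every point. *)
Definition nonsingular (n : nat) : Prop :=
  forall x : X, exists e : 'I_n -> fiber x (submod (max_ideal x)), is_basis e.

Definition nonsingular_affine_variety (n : nat) : Prop :=
  [/\ locally_closed X, irreducible_set X, affine_set X, has_dim X n
    & nonsingular n].

End Smooth.

Section PrincipalParts.
Variable X : set pt.

(* Functions on X x X, as a ring and as an O_X-module via pr_1. *)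
Definition fun2 := ((X * X)%type -> F).

HB.instance Definition _ := GRing.ComPzRing.on fun2.

Definition fun2_scale (a : reg X) (g : fun2) : fun2 := (fun z => ev z.1 a) * g.

Lemma fun2_scaleA a b g : fun2_scale a (fun2_scale b g) = fun2_scale (a * b) g.
Proof. by rewrite /fun2_scale mulrA. Qed.

Lemma fun2_scale1 : left_id 1 fun2_scale.
Proof. by move=> g; rewrite /fun2_scale mul1r. Qed.

Lemma fun2_scaleDr : right_distributive fun2_scale +%R.
Proof. by move=> a g h; rewrite /fun2_scale mulrDr. Qed.

Lemma fun2_scaleDl g : {morph fun2_scale^~ g : a b / a + b}.
Proof. by move=> a b; rewrite /fun2_scale -mulrDl. Qed.

HB.instance Definition _ := GRing.Zmodule_isLmodule.Build (reg X) fun2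
  fun2_scaleA fun2_scale1 fun2_scaleDr fun2_scaleDl.

Definition pull1 (a : reg X) : fun2 := fun z => val a z.1.
Definition pull2 d (m : sect d X) : fun2 := fun z => val m z.2.

(* O_X-span of the pr_2^* m, i.e. pr_2^* O(d) = O_X (x)_F O(d) for X affine; for
   d = 0 this is O_(X x X). *)
Definition pr2 (d : int) : {pred fun2} := span (range (@pull2 d)).

HB.instance Definition _ d := GRing.SubmodClosed.on (pr2 d).

Definition diag_ideal : {pred fun2} :=
  [pred g | (g \in pr2 0) && `[< forall x : X, g (x, x) = 0 >]].

Lemma diag_ideal_closed : submod_closed diag_ideal.
Proof.
split=> [|a u v /andP[hu /asboolP u0] /andP[hv /asboolP v0]]; apply/andP; split.
- exact: (rpred0 (pr2 0)).
- exact/asboolP.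
- by apply: (rpredD (V := fun2)) => //; apply: rpredZ.
apply/asboolP => x.
suff -> : (a *: u + v) (x, x) = ev x a * u (x, x) + v (x, x).
  by rewrite u0 v0 mulr0 addr0.
by [].
Qed.

HB.instance Definition _ :=
  GRing.isSubmodClosed.Build (reg X) fun2 diag_ideal diag_ideal_closed.

(* I_Delta^k pr_2^* O(d) *)
Fixpoint diag_pow (d : int) (k : nat) : submodClosed fun2 :=
  if k is k'.+1 then
    span [set g | exists2 u : fun2, u \in diag_ideal &
                    exists2 v : fun2, v \in diag_pow d k' & g = u * v]
  else pr2 d.

(* P^k(O(d)), as an O_X-module via pr_1. *)
Definition PP (d : int) (k : nat) := subquot (pr2 d) (diag_pow d k.+1).

HB.instance Definition _ d k := GRing.Lmodule.on (PP d k).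

Definition PP_cls d k (g : fun2) : PP d k := cls (pr2 d) (diag_pow d k.+1) g.

Definition dprin d k (m : sect d X) : PP d k := PP_cls d k (pull2 m).

Definition Omega := subquot diag_ideal (diag_pow 0 2).

HB.instance Definition _ := GRing.Lmodule.on Omega.

(* d s = d^k s - s, before taking classes. *)
Definition diff2 (s : reg X) : fun2 := fun z => val s z.2 - val s z.1.

Definition dif (s : reg X) : Omega := cls diag_ideal (diag_pow 0 2) (diff2 s).

(* V (x) O_X *)
Definition VO := {ffun 'I_r.+1 -> (reg X)^o}.
(* V (x) L^* *)
Definition VLd := {ffun 'I_r.+1 -> sect (-1) X}.

HB.instance Definition _ := GRing.Lmodule.on VO.
HB.instance Definition _ := GRing.Lmodule.on VLd.

Definition tens (T : V) (a : reg X) : VO := [ffun j => cst_reg X (T j 0) * a].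

Definition alpha k (v : VO) : PP 1 k :=
  \sum_j v j *: dprin k (linform X (delta_mx j 0)).

(* R_k, as the image of (ker alpha_k) (x) L^* in V (x) L^*. *)
Definition Rk (k : nat) : {pred VLd} :=
  span [set xi | exists v l, alpha k v = 0 /\ xi = [ffun j => (v j : reg X) *: l]].

HB.instance Definition _ k := GRing.SubmodClosed.on (Rk k).

Definition in_Rk k (xi : VLd) (h : xi \in Rk k) : submod (Rk k) :=
  exist (fun v => v \in Rk k) xi h.

Definition twist (xi : VLd) (l : sect 1 X) : VO := [ffun j => pairing (xi j) l].

(* S^k Omega (x) L -> P^k(L), w_1 ... w_k (x) l |-> w_1 ... w_k d^k_L(l). *)
Definition theta k (w : Sym k Omega) (l : sect 1 X) : PP 1 k :=
  sym_lift id
    (fun u => PP_cls 1 k ((\prod_j (subrep (u j) : fun2)) * pull2 l)) w.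

(* F_k^*, defined for k >= 1: [alpha_k] on [R_(k-1) (x) L] followed by the
   inverse of [theta], twisted by L^*. *)
Definition fund k (xi : submod (Rk k.-1)) : Sym k Omega :=
  xget 0 [set w | forall l, alpha k (twist (val xi) l) = theta w l].

(* F_j^* is defined at xi and vanishes there. *)
Definition fund_vanishes (j : nat) (xi : VLd) : Prop :=
  exists h : xi \in Rk j.-1, fund (k := j) (in_Rk h) = 0.

(* F_(k,x)^* *)
Definition fund_at k (x : X) (v : fiber x (submod (Rk k.-1))) :
    Sym k (fiber x Omega) :=
  sym_lift (@ev X x) (fun u => symprod [ffun j => fiber_cls x (u j)])
    (fund (fiber_rep v)).

(* D_p(e), the coefficient of ds^p in d^k(e). *)
Definition Dop n k (s : 'I_n -> reg X) (p : 'X_{1..n < k.+1}) (e : sect 0 X) :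
    reg X :=
  coord (fun q : 'X_{1..n < k.+1} => PP_cls 0 k (\prod_i diff2 (s i) ^+ q i))
    (dprin k e) p.

End PrincipalParts.

Section Coordinates.
Variable U : set pt.
Implicit Types (T : 'I_r.+1 -> V) (t : 'I_r -> reg U) (f : reg U).

(* T_0 is [T ord0], and [t i] stands for t_(i+1). *)
Definition adapted T t : Prop :=
  [/\ is_basis T,
      forall m : sect 1 U, exists! a : reg U, m = a *: linform U (T ord0),
      forall i, linform U (T (lift ord0 i)) = t i *: linform U (T ord0)
    & is_basis (fun i => dif (t i))].

Definition partial t f (i : 'I_r) : reg U :=
  coord (fun i => dif (t i)) (dif f) i.

Variables (X : set pt) (hXU : X `<=` U).

Definition inclusion (x : X) : U :=
  exist (fun y => y \in U) (val x) (mem_set (hXU (set_mem (valP x)))).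

Lemma restrict_subproof f : (fun x : X => val f (inclusion x)) \in reg_pred X.
Proof.
have /section_predP hf := valP f; apply/section_predP => x x0.
have [m [e [p [q [hp hq hd qx Ef]]]]] := hf (inclusion x) x0.
by exists m, e, p, q; split=> // y qy; rewrite Ef.
Qed.

Definition restrict f : reg X :=
  exist (fun g => g \in reg_pred X) _ (restrict_subproof f).

Definition ideal_of : {pred (reg U)^o} := [pred f : reg U | restrict f == 0].

Lemma ideal_of_closed : submod_closed ideal_of.
Proof.
split=> [|a u v /eqP hu /eqP hv]; apply/eqP; first exact: val_inj.
have -> : restrict (a *: u + v) = restrict a * restrict u + restrict v.
  exact: val_inj.
by rewrite hu hv mulr0 addr0.
Qed.

HB.instance Definition _ :=
  GRing.isSubmodClosed.Build (reg U) (reg U)^o ideal_of ideal_of_closed.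

Definition ideal_sq : {pred (reg U)^o} :=
  span [set f : (reg U)^o | exists2 g : reg U, g \in ideal_of &
                  exists2 h : reg U, h \in ideal_of & f = g * h].

HB.instance Definition _ := GRing.SubmodClosed.on ideal_sq.

(* N_X^* = I_X / I_X^2 *)
Definition conormal := subquot ideal_of ideal_sq.

Definition conormal_cls f : conormal := cls ideal_of ideal_sq f.

(* The image of fbar (x) t_0 under N_X^* (x) L -> V (x) O_X. *)
Definition incl_t0 T t (fb : conormal) : VO X :=
  \sum_(i < r) restrict (partial t (subrep fb) i) *:
    (tens (T (lift ord0 i)) 1 - tens (T ord0) (restrict (t i))).

(* The generator of L^* dual to the generator t_0 of L. *)
Definition t0dual T : sect (-1) X :=
  xget 0 [set l | pairing l (linform X (T ord0)) = 1].

(* The resulting inclusion of N_X^* into V (x) L^*. *)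
Definition conormal_incl T t (fb : conormal) : VLd X :=
  [ffun j => (incl_t0 T t fb j : reg X) *: t0dual T].

Variables (n k : nat) (s : 'I_n -> reg X).

Definition local_form t f : Sym k (Omega X) :=
  \sum_(i < r) restrict (partial t f i) *:
    \sum_(p : 'X_{1..n < k.+1} | mdeg p == k)
      Dop s p (restrict (t i)) *: sym_monomial k (fun j => dif (s j)) p.

Definition local_form_at (x : X) t f : Sym k (fiber x (Omega X)) :=
  \sum_(i < r) ev x (restrict (partial t f i)) *:
    \sum_(p : 'X_{1..n < k.+1} | mdeg p == k)
      ev x (Dop s p (restrict (t i))) *:
        sym_monomial k (fun j => fiber_cls x (dif (s j))) p.

End Coordinates.

End ProjectiveSpace.

(* Main.v *)
Require Import Defs.
From mathcomp Require Import all_boot all_order all_algebra.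
From mathcomp Require Import all_classical reals complex.
From mathcomp Require Import mpoly.
From HB Require Import structures.
From mathcomp Require Import perm ring.

(* Since ds_1, ..., ds_n is a basis of Omega, its dual basis gives derivations of
   O_X with D_i(s_j) = delta_ij. In characteristic 0, differentiating a Taylor
   polynomial in the s_i - s_i(x) shows that it cannot vanish to order m at x
   unless its coefficients of degree < m are zero; so the ds^p are independent
   modulo powers of the diagonal ideal, and as they span P^k they form a basis.
   In particular S^k Omega (x) L -> P^k(L) is injective with image the kernel of
   the truncation, and fund is the unique factorisation of alpha_k through it.
   The vector v representing fbar (x) t_0 has
   alpha_k(v) = sum_i c_i (t_i(y) - t_i(x)) t_0(y), with c_i the restriction of
   df/dt_i; expanding t_i(y) - t_i(x) in the ds^p yields the local form, since the
   coefficients of degree < k vanish when alpha_(k-1)(v) = 0. *)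

Import Defs.
Import GRing.Theory.
Local Open Scope classical_set_scope.
Local Open Scope ring_scope.

Set Implicit Arguments.
Unset Strict Implicit.
Unset Printing Implicit Defensive.

Section Spans.
Variables (B : comPzRingType) (M : lmodType B).
Implicit Types (S : set M) (P : M -> Prop).

Lemma span_ind S P : P 0 -> (forall a u v, P u -> P v -> P (a *: u + v)) ->
  (forall u, S u -> P u) -> forall v, v \in span S -> P v.
Proof.
move=> P0 PD PS v /asboolP hv.
pose Q : {pred M} := [pred u | `[< P u >]].
have Qc : submod_closed Q.
  by split=> [|a u w /asboolP hu /asboolP hw]; apply/asboolP; [|exact: PD].
pose N : submodClosed M := HB.pack Q (GRing.isSubmodClosed.Build B M Q Qc).
by apply/asboolP; apply: (hv N) => u /PS/asboolP.
Qed.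

Lemma mem_span S u : S u -> u \in span S.
Proof. by move=> Su; apply/asboolP => N; apply. Qed.

Lemma span_sum (I : finType) (P : pred I) (e : I -> M) S v :
  (forall u, S u -> exists2 i, P i & u = e i) -> v \in span S ->
  exists c : I -> B, v = \sum_(i | P i) c i *: e i.
Proof.
move=> SE; move: v; apply: span_ind => [|a u w [c ->] [d ->]|_ /SE[i Pi ->]].
- by exists (fun=> 0); rewrite big1// => i _; rewrite scale0r.
- exists (fun i => a * c i + d i); rewrite scaler_sumr -big_split/=.
  by apply: eq_bigr => i _; rewrite scalerDl scalerA.
- exists (fun j => (j == i)%:R); rewrite (bigD1 i)//= eqxx scale1r big1 ?addr0//.
  by move=> j /andP[_ /negPf ->]; rewrite scale0r.
Qed.

End Spans.

Section BasisCoordinates.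
Variables (B : comPzRingType) (M : lmodType B) (I : finType) (e : I -> M).

Lemma is_basisP : (forall v, exists c : I -> B, v = \sum_i c i *: e i) ->
  (forall c : I -> B, \sum_i c i *: e i = 0 -> forall i, c i = 0) -> is_basis e.
Proof.
move=> gen free v; have [c vE] := gen v; exists (finfun c); split.
  by rewrite vE; apply: eq_bigr => i _; rewrite ffunE.
move=> d vE'; apply/ffunP => i; rewrite ffunE.
apply/eqP; rewrite -subr_eq0; apply/eqP; move: i; apply: free.
under eq_bigr do rewrite scalerBl.
by rewrite sumrB -vE -vE' subrr.
Qed.

Hypothesis he : is_basis e.

Lemma coord_sum v : v = \sum_i coord e v i *: e i.
Proof.
rewrite /coord; case: xgetP => [c _ //|no].
by have [c [hc _]] := he v; case: (no (c : I -> B)).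
Qed.

Lemma is_basis_free (c : I -> B) : \sum_i c i *: e i = 0 -> forall i, c i = 0.
Proof.
move=> c0 i; have [d [_ d0]] := he 0.
have E : finfun c = [ffun=> 0].
  rewrite -(d0 (finfun c)); last first.
    by rewrite -[LHS]c0; apply: eq_bigr => j _; rewrite ffunE.
  apply: d0; rewrite big1// => j _; rewrite ffunE; exact: scale0r.
by move/ffunP/(_ i): E; rewrite !ffunE.
Qed.

Lemma coord_uniq (c : I -> B) v : v = \sum_i c i *: e i -> forall i, coord e v i = c i.
Proof.
move=> vE i; apply/eqP; rewrite -subr_eq0; apply/eqP; move: i; apply: is_basis_free.
under eq_bigr do rewrite scalerBl.
by rewrite sumrB -vE -coord_sum subrr.
Qed.

Lemma coordP a u v i : coord e (a *: u + v) i = a * coord e u i + coord e v i.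
Proof.
apply: (@coord_uniq (fun i => a * coord e u i + coord e v i)).
rewrite {1}(coord_sum u) {1}(coord_sum v) scaler_sumr -big_split/=.
by apply: eq_bigr => j _; rewrite scalerDl scalerA.
Qed.

Lemma coord_basisE i j : coord e (e j) i = (i == j)%:R.
Proof.
apply: (@coord_uniq (fun i => (i == j)%:R)).
rewrite (bigD1 j)//= eqxx scale1r big1 ?addr0// => l /negPf ->.
by rewrite scale0r.
Qed.

End BasisCoordinates.

Section Subquotients.
Variables (B : comPzRingType) (E : lmodType B) (M N : submodClosed E).
Local Notation cl := (cls M N).

Lemma val_insub_mem u : u \in M -> val (insubd (0 : submod M) u) = u.
Proof. by move=> Mu; rewrite val_insubd Mu. Qed.

Lemma cls_eqP u v : u \in M -> v \in M -> cl u = cl v <-> u - v \in N.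
Proof.
move=> Mu Mv.
have -> : (u - v \in N) = (insubd (0 : submod M) u - insubd 0 v \in @sub_pred B E M N).
  by rewrite inE raddfB/= !val_insub_mem.
by split=> [/coset_eqP//|h]; apply/coset_eqP.
Qed.

Lemma clsP a u v : u \in M -> v \in M -> cl (a *: u + v) = a *: cl u + cl v.
Proof.
move=> Mu Mv; rewrite /cls -linearP; congr coset; apply: val_inj.
by rewrite linearP/= !val_insub_mem// rpredD ?rpredZ.
Qed.

Lemma cls0 : cl 0 = 0.
Proof. by have := @clsP (-1) 0 0 (rpred0 _) (rpred0 _); rewrite scaler0 add0r scaleN1r addNr. Qed.

Lemma cls_eq0P u : u \in M -> cl u = 0 <-> u \in N.
Proof. by move=> Mu; rewrite -cls0 cls_eqP ?rpred0// subr0. Qed.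

Lemma clsD u v : u \in M -> v \in M -> cl (u + v) = cl u + cl v.
Proof. by move=> Mu Mv; rewrite -[u]scale1r clsP// !scale1r. Qed.

Lemma clsZ a u : u \in M -> cl (a *: u) = a *: cl u.
Proof. by move=> Mu; rewrite -[a *: u]addr0 clsP ?rpred0// cls0 addr0. Qed.

Lemma cls_sum (I : Type) (r : seq I) (P : pred I) (f : I -> E) :
  (forall i, P i -> f i \in M) -> cl (\sum_(i <- r | P i) f i) = \sum_(i <- r | P i) cl (f i).
Proof.
move=> Mf; suff [] : \sum_(i <- r | P i) f i \in M /\
   cl (\sum_(i <- r | P i) f i) = \sum_(i <- r | P i) cl (f i) by [].
elim/big_ind2 : _ => [|u u' v v' [Mu uE] [Mv vE]|i /Mf //].
- by rewrite rpred0 cls0.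
- by rewrite rpredD// clsD// uE vE.
Qed.

Lemma subrep_mem (v : subquot M N) : subrep v \in M.
Proof. exact: valP. Qed.

Lemma subrepK (v : subquot M N) : cl (subrep v) = v.
Proof. by rewrite /cls /subrep valKd repK. Qed.

Lemma cls_surj (v : subquot M N) : exists2 u, u \in M & v = cl u.
Proof. by exists (subrep v); [exact: subrep_mem|rewrite subrepK]. Qed.

Lemma subrep_cls u : u \in M -> subrep (cl u) - u \in N.
Proof. by move=> Mu; apply/cls_eqP => //; [exact: subrep_mem|exact: subrepK]. Qed.

Lemma subrepP a (u v : subquot M N) :
  subrep (a *: u + v) - (a *: subrep u + subrep v) \in N.
Proof.
have Mu := subrep_mem u; have Mv := subrep_mem v.
rewrite -{1}(subrepK u) -{1}(subrepK v) -clsP//; apply: subrep_cls.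
by rewrite rpredD ?rpredZ.
Qed.

End Subquotients.

Section SymmetricPowers.
Variables (B : comPzRingType) (k : nat) (Q : lmodType B).
Implicit Types (w : {ffun 'I_k -> Q}) (g : {ffun 'I_k -> Q} -> B^o).

Local Notation gens := (span (sym_gens (B := B) (k := k) (Q := Q))).
Local Notation rels := (span (sym_rels (B := B) (k := k) (Q := Q))).

Lemma delta_gens w : delta w \in gens.
Proof. by apply: mem_span; exists w. Qed.

Lemma sym_ind (P : Sym k Q -> Prop) :
  P 0 -> (forall a u v, P u -> P v -> P (a *: u + v)) ->
  (forall w, P (symprod w)) -> forall v, P v.
Proof.
move=> P0 PD Pg v; have [g hg ->] := cls_surj v.
suff [] : g \in gens /\ P (cls gens rels g) by [].
move: g hg; apply: span_ind => [|a g g' [hg Pcg] [hg' Pcg']|_ [w _ <-]].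
- by rewrite rpred0 cls0.
- by rewrite rpredD ?rpredZ// clsP//; split=> //; exact: PD.
- by rewrite delta_gens; split=> //; exact: Pg.
Qed.

Lemma symprod_slot w j a u v :
  symprod (slot w j (a *: u + v)) = a *: symprod (slot w j u) + symprod (slot w j v).
Proof.
rewrite /symprod -clsP ?delta_gens//; apply/cls_eqP.
- exact: delta_gens.
- by rewrite rpredD ?rpredZ ?delta_gens.
- by apply: mem_span; left; exists w, j, a, u, v; rewrite opprD addrA.
Qed.

Lemma symprod_perm w (s : 'S_k) : symprod [ffun j => w (s j)] = symprod w.
Proof.
by apply/cls_eqP; rewrite ?delta_gens//; apply: mem_span; right; exists w, s.
Qed.

Lemma slot_id w j : slot w j (w j) = w.
Proof. by apply/ffunP => i; rewrite ffunE; case: eqP => // ->. Qed.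

Section Lift.
Variables (B' : comPzRingType) (Z : lmodType B') (h : B -> B').
Variable phi : {ffun 'I_k -> Q} -> Z.
Hypotheses (h1 : h 1 = 1) (hD : {morph h : a b / a + b}) (hM : {morph h : a b / a * b}).
Hypothesis phi_slot : forall w j a u v,
  phi (slot w j (a *: u + v)) = h a *: phi (slot w j u) + phi (slot w j v).
Hypothesis phi_perm : forall w (s : 'S_k), phi [ffun j => w (s j)] = phi w.

Let h0 : h 0 = 0.
Proof. by apply: (@addIr _ (h 0)); rewrite add0r -hD add0r. Qed.

Let hN a : h (- a) = - h a.
Proof. by apply/eqP; rewrite -addr_eq0 -hD addNr h0. Qed.

Let supp g := exists r : seq {ffun 'I_k -> Q}, forall w, w \notin r -> g w = 0.

Let lin g : Z := \sum_(w \in [set: {ffun 'I_k -> Q}]) h (g w) *: phi w.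

Let linE g (r : seq {ffun 'I_k -> Q}) : uniq r -> (forall w, w \notin r -> g w = 0) ->
  lin g = \sum_(w <- r) h (g w) *: phi w.
Proof.
move=> ur gr; rewrite /lin (fsbigE r)//.
  by apply: eq_bigl => w; rewrite in_setT.
by move=> w _ /gr ->; rewrite h0 scale0r.
Qed.

Let suppP a g g' : supp g -> supp g' -> supp (a *: g + g').
Proof.
move=> [r hr] [r' hr']; exists (r ++ r') => w.
rewrite mem_cat negb_or => /andP[/hr + /hr'] /=.
by rewrite /GRing.add/= /GRing.scale/= /GRing.scale/= => -> ->; rewrite mulr0 addr0.
Qed.

Let linP a g g' : supp g -> supp g' -> lin (a *: g + g') = h a *: lin g + lin g'.
Proof.
move=> [r hr] [r' hr']; pose R := undup (r ++ r').
have Rr w : w \notin R -> g w = 0 /\ g' w = 0.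
  by rewrite mem_undup mem_cat negb_or => /andP[/hr ? /hr' ?].
have EE w : (a *: g + g') w = a * g w + g' w by [].
rewrite !(@linE _ R) ?undup_uniq//; try by move=> w /Rr[].
  rewrite scaler_sumr -big_split/=; apply: eq_bigr => w _.
  by rewrite EE hD hM scalerDl scalerA.
by move=> w /Rr[g0 g'0]; rewrite EE g0 g'0 mulr0 addr0.
Qed.

Let supp_delta w : supp (delta w).
Proof. by exists [:: w] => w'; rewrite inE /delta => /negPf ->. Qed.

Let lin_delta w : lin (delta w) = phi w.
Proof.
rewrite (@linE _ [:: w])// ?big_seq1; last first.
  by move=> w'; rewrite inE /delta => /negPf ->.
by rewrite /delta eqxx h1 scale1r.
Qed.

Let supp_gens g : g \in gens -> supp g.
Proof.
move: g; apply: span_ind => [|a g g'|_ [w _ <-]].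
- by exists [::].
- exact: suppP.
- exact: supp_delta.
Qed.

Let lin_rels g : g \in rels -> supp g /\ lin g = 0.
Proof.
move: g; apply: span_ind => [|a g g' [sg g0] [sg' g'0]|d].
- split; first by exists [::].
  by rewrite (@linE _ [::])// big_nil.
- by split; [exact: suppP|rewrite linP// g0 g'0 scaler0 addr0].
case=> [[w [j [a [u [v ->]]]]]|[w [s ->]]].
- set d1 := delta _; set d2 := delta _; set d3 := delta _.
  have -> : d1 - a *: d2 - d3 = (- a) *: d2 + ((-1) *: d3 + d1).
    by rewrite scaleN1r scaleNr [RHS]addrC [- d3 + d1]addrC addrAC.
  split; first by apply: suppP; [|apply: suppP]; exact: supp_delta.
  rewrite !linP//; try exact: supp_delta;
    last by apply: suppP; exact: supp_delta.
  by rewrite !lin_delta phi_slot !hN h1 scaleN1r scaleNr [h a *: _ + _]addrC addKr addNr.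
- have -> : delta [ffun j => w (s j)] - delta w = (-1) *: delta w + delta [ffun j => w (s j)].
    by rewrite scaleN1r addrC.
  split; first by apply: suppP; exact: supp_delta.
  rewrite linP ?lin_delta ?phi_perm; try exact: supp_delta.
  by rewrite hN h1 scaleN1r addNr.
Qed.

Let sym_lift_cls g : g \in gens -> sym_lift h phi (cls gens rels g) = lin g.
Proof.
move=> gg; rewrite -[LHS]/(lin (subrep (cls gens rels g))).
have /lin_rels[sd d0] := subrep_cls rels gg.
rewrite -[subrep _](subrK g) -[_ - _]scale1r linP//; last exact: supp_gens.
by rewrite d0 scaler0 add0r.
Qed.

Lemma sym_liftP a u v :
  sym_lift h phi (a *: u + v) = h a *: sym_lift h phi u + sym_lift h phi v.
Proof.
have [g hg ->] := cls_surj u; have [g' hg' ->] := cls_surj v.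
rewrite -clsP// !sym_lift_cls// ?rpredD ?rpredZ//.
by apply: linP; apply: supp_gens.
Qed.

Lemma sym_lift_symprod w : sym_lift h phi (symprod w) = phi w.
Proof. by rewrite sym_lift_cls ?delta_gens. Qed.

Lemma sym_lift0 : sym_lift h phi 0 = 0.
Proof.
have := sym_liftP (-1) 0 0; rewrite scaler0 add0r => ->.
by rewrite hN h1 scaleN1r addNr.
Qed.

Lemma sym_lift_sum (I : Type) (r : seq I) (P : pred I) (c : I -> B) (F : I -> Sym k Q) :
  sym_lift h phi (\sum_(i <- r | P i) c i *: F i) =
  \sum_(i <- r | P i) h (c i) *: sym_lift h phi (F i).
Proof.
elim/big_rec2: _ => [|i y x _ <-]; first exact: sym_lift0.
exact: sym_liftP.
Qed.

End Lift.

End SymmetricPowers.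

Section SymmetricMonomials.
Variables (B : comPzRingType) (k : nat) (Q : lmodType B) (n : nat) (e : 'I_n -> Q).
Implicit Types (w : {ffun 'I_k -> Q}).

Lemma symprod_sum w j (I : finType) (c : I -> B) (u : I -> Q) :
  symprod (slot w j (\sum_i c i *: u i)) = \sum_i c i *: symprod (slot w j (u i)).
Proof.
elim/big_rec2: _ => [|i y x _ <-]; last exact: symprod_slot.
have := symprod_slot w j (-1) 0 0; rewrite scaler0 add0r => ->.
by rewrite scaleN1r addNr.
Qed.

Definition sym_monomials : set (Sym k Q) :=
  [set u | exists2 p : 'X_{1..n}, mdeg p = k & u = sym_monomial k e p].

Lemma symprod_monomial (f : 'I_k -> 'I_n) :
  symprod [ffun j => e (f j)] \in span sym_monomials.
Proof.
pose tf := mktuple f; pose p := s2m tf.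
have sz : size (m2s p) == k.
  rewrite size_m2s -[X in _ == X](size_tuple tf) -sum1_size mdegE; apply/eqP.
  rewrite (eq_bigr (fun i => \sum_(j <- tf | j == i) 1)%N); last first.
    by move=> i _; rewrite mnmE sum1_count.
  rewrite (exchange_big_dep predT)//=; apply: eq_bigr => i _.
  by rewrite (eq_bigl _ _ (eq_sym _)) big_pred1_eq.
have /tuple_permP[s sE] : perm_eq (Tuple sz) tf.
  apply/allP => i _ /=; apply/eqP.
  by have /mnmP/(_ i) := s2mK p; rewrite !mnmE.
apply: mem_span; exists p; first by rewrite -size_m2s (eqP sz).
rewrite -(symprod_perm _ s); congr symprod; apply/ffunP => j; rewrite !ffunE.
rewrite (nth_map (f j)) ?(eqP sz)//; congr e.
have -> : m2s p = Tuple sz by [].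
by rewrite sE (nth_mktuple (fun i => tnth tf (s i)) _ j) tnth_mktuple.
Qed.

Lemma sym_span_monomials : is_basis e -> forall v, v \in span sym_monomials.
Proof.
move=> he; apply: sym_ind => [|a u v hu hv|w]; first exact: rpred0.
  by rewrite rpredD ?rpredZ.
suff H j : (j <= k)%N ->
    forall w, (forall i : 'I_k, (j <= i)%N -> exists l, w i = e l) ->
    symprod w \in span sym_monomials.
  by apply: (H k) => // i; rewrite leqNgt ltn_ord.
elim: j => [_|j IH jk] {}w hw.
  have /choice[f fE] : forall i, exists l, w i = e l by move=> i; exact: hw.
  have -> : w = [ffun i => e (f i)] by apply/ffunP => i; rewrite ffunE fE.
  exact: symprod_monomial.
pose j' := Ordinal jk.
rewrite -(slot_id w j') (coord_sum he (w j')) symprod_sum.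
apply: rpred_sum => l _; apply: rpredZ; apply: IH; first exact: ltnW.
move=> i ji; rewrite ffunE; case: eqP => [_|ij]; first by exists l.
apply: hw; rewrite ltn_neqAle ji andbT; apply/eqP => jE.
by apply: ij; apply: val_inj.
Qed.

End SymmetricMonomials.

Section DiagonalPowers.
Variables (F : fieldType) (r : nat) (X : set 'rV[F]_r.+1).
Implicit Types (a b : reg X) (u v g : fun2 X) (d e : int).

Lemma fun2_scaleE a g : a *: g = pull1 a * g. Proof. by []. Qed.

Lemma fun2_scalerAl a u v : a *: u * v = a *: (u * v).
Proof. by rewrite !fun2_scaleE mulrA. Qed.

Lemma fun2_scalerAr a u v : u * (a *: v) = a *: (u * v).
Proof. by rewrite !fun2_scaleE mulrCA. Qed.

Lemma pull2_mem d (m : sect d X) : pull2 m \in @pr2 F r X d.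
Proof. by apply: mem_span; exists m. Qed.

Lemma pr2_1 : 1 \in @pr2 F r X 0.
Proof. exact: (@pull2_mem 0 (1 : reg X)). Qed.

Lemma pull1_mem a : pull1 a \in @pr2 F r X 0.
Proof. by rewrite -[pull1 a]mulr1 -fun2_scaleE rpredZ ?pr2_1. Qed.

Lemma pr2M d e u v : u \in @pr2 F r X d -> v \in @pr2 F r X e -> u * v \in @pr2 F r X (d + e).
Proof.
move=> hu; move: v; apply: span_ind => [|a v w hv hw|_ [m' _ <-]].
- by rewrite mulr0 rpred0.
- by rewrite mulrDr fun2_scalerAr rpredD ?rpredZ.
move: u hu; apply: span_ind => [|a v w hv hw|_ [m _ <-]].
- by rewrite mul0r rpred0.
- by rewrite mulrDl fun2_scalerAl rpredD ?rpredZ.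
have mm' : val m * val m' \in @section_pred F r (d + e) X.
  by apply/section_predP; apply: is_sectionM; apply/section_predP; exact: valP.
exact: (@pull2_mem _ (Sub (val m * val m') mm' : sect (d + e) X)).
Qed.

Lemma diag_ideal_pr2 u : u \in @diag_ideal F r X -> u \in @pr2 F r X 0.
Proof. by case/andP. Qed.

Lemma diag_powS_ind d k (P : fun2 X -> Prop) :
  P 0 -> (forall a u v, P u -> P v -> P (a *: u + v)) ->
  (forall u v, u \in @diag_ideal F r X -> v \in diag_pow X d k -> P (u * v)) ->
  forall g, g \in diag_pow X d k.+1 -> P g.
Proof.
by move=> P0 PD PM; apply: span_ind => // _ [u hu [v hv ->]]; exact: PM.
Qed.

Lemma diag_powS d k u v :
  u \in @diag_ideal F r X -> v \in diag_pow X d k -> u * v \in diag_pow X d k.+1.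
Proof. by move=> hu hv; apply: mem_span; exists u => //; exists v. Qed.

Lemma diag_pow_pr2M d e k u v :
  u \in @pr2 F r X d -> v \in diag_pow X e k -> u * v \in diag_pow X (d + e) k.
Proof.
move=> hu; elim: k v => [|k IH]; first by move=> v hv; exact: pr2M.
apply: diag_powS_ind => [|a v w hv hw|v w hv hw].
- by rewrite mulr0 rpred0.
- by rewrite mulrDr fun2_scalerAr rpredD ?rpredZ.
- by rewrite mulrCA; apply: diag_powS => //; exact: IH.
Qed.

Lemma diag_pow_mull d k u v :
  u \in @pr2 F r X 0 -> v \in diag_pow X d k -> u * v \in diag_pow X d k.
Proof. by move=> hu hv; rewrite -[d]add0r; exact: diag_pow_pr2M. Qed.

Lemma diag_pow_mulr d k u v :
  u \in @pr2 F r X 0 -> v \in diag_pow X d k -> v * u \in diag_pow X d k.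
Proof. by rewrite mulrC; exact: diag_pow_mull. Qed.

Lemma diag_powSW d k g : g \in diag_pow X d k.+1 -> g \in diag_pow X d k.
Proof.
move: g; apply: diag_powS_ind => [|a v w hv hw|u v /diag_ideal_pr2 hu hv].
- exact: rpred0.
- by rewrite rpredD ?rpredZ.
- exact: diag_pow_mull.
Qed.

Lemma diag_pow_le d k l g : (l <= k)%N -> g \in diag_pow X d k -> g \in diag_pow X d l.
Proof.
move/subnK <-; elim: (k - l)%N => [|i IH]; first by rewrite add0n.
by rewrite addSn => /diag_powSW.
Qed.

Lemma diag_pow_pr2 d k g : g \in diag_pow X d k -> g \in @pr2 F r X d.
Proof. exact: (@diag_pow_le d k 0%N). Qed.

Lemma diag_ideal_pow1 u : u \in @diag_ideal F r X -> u \in diag_pow X 0 1.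
Proof. by move=> hu; rewrite -[u]mulr1; apply: diag_powS => //; exact: pr2_1. Qed.

Lemma diag_pow1_ideal u : u \in diag_pow X 0 1 -> u \in @diag_ideal F r X.
Proof.
move: u; apply: diag_powS_ind => [|a v w hv hw|u v /andP[hu /asboolP u0] hv].
- exact: rpred0.
- by rewrite rpredD ?rpredZ.
- apply/andP; split; first exact: (pr2M hu hv).
  by apply/asboolP => x; rewrite -[_ (x, x)]/(u (x, x) * v (x, x)) u0 mul0r.
Qed.

Lemma diag_powS_ideal k u : u \in diag_pow X 0 k.+1 -> u \in @diag_ideal F r X.
Proof. by move=> hu; apply: diag_pow1_ideal; exact: diag_pow_le hu. Qed.

Lemma diag_powM d k l u v :
  u \in diag_pow X 0 k -> v \in diag_pow X d l -> u * v \in diag_pow X d (k + l).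
Proof.
move=> hu hv; elim: k u hu => [|k IH] u; first by move=> hu; exact: diag_pow_mull.
rewrite addSn; move: u; apply: diag_powS_ind => [|a u w hu hw|u w hu hw].
- by rewrite mul0r rpred0.
- by rewrite mulrDl fun2_scalerAl rpredD ?rpredZ.
- by rewrite -mulrA; apply: diag_powS => //; exact: IH.
Qed.

Lemma diag_pow_prod (s : seq (fun2 X)) :
  {in s, forall u, u \in @diag_ideal F r X} -> \prod_(u <- s) u \in diag_pow X 0 (size s).
Proof.
elim: s => [_|u s IH hs]; first by rewrite big_nil; exact: pr2_1.
rewrite big_cons; apply: diag_powS; first by apply: hs; rewrite mem_head.
by apply: IH => v vs; apply: hs; rewrite inE vs orbT.
Qed.

Lemma diag_pow_twist d e k g (m : sect e X) :
  g \in diag_pow X d k -> g * pull2 m \in diag_pow X (e + d) k.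
Proof. by rewrite mulrC; apply: diag_pow_pr2M; exact: pull2_mem. Qed.

Lemma diff2_ideal a : diff2 a \in @diag_ideal F r X.
Proof.
apply/andP; split; last by apply/asboolP => x; rewrite /diff2 /= subrr.
rewrite (_ : diff2 a = (@pull2 F r X 0 a : fun2 X) - (pull1 a : fun2 X))//.
by rewrite rpredB ?pull2_mem// pull1_mem.
Qed.

Lemma diag_pow_sub_prod k d (I : eqType) (s : seq I) (f g : I -> fun2 X) v :
  size s = k -> v \in @pr2 F r X d ->
  {in s, forall i, f i \in @diag_ideal F r X} -> {in s, forall i, g i \in @diag_ideal F r X} ->
  {in s, forall i, f i - g i \in diag_pow X 0 2} ->
  \prod_(i <- s) f i * v - \prod_(i <- s) g i * v \in diag_pow X d k.+1.
Proof.
move=> <- hv; elim: s => [|i s IH] hf hg hfg.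
  by rewrite !big_nil subrr rpred0.
have [hf' hg' hfg'] : [/\ {in s, forall i, f i \in @diag_ideal F r X},
    {in s, forall i, g i \in @diag_ideal F r X} &
    {in s, forall i, f i - g i \in diag_pow X 0 2}].
  by split=> j js; [apply: hf|apply: hg|apply: hfg]; rewrite inE js orbT.
have hPs : \prod_(i <- s) f i \in diag_pow X 0 (size s).
  rewrite -(big_map f predT id) -(size_map f); apply: diag_pow_prod.
  by move=> _ /mapP[j js ->]; exact: hf'.
have his : i \in i :: s by rewrite mem_head.
rewrite !big_cons -!mulrA.
set p := _ * v; set q := _ * v.
have -> : f i * p - g i * q = (f i - g i) * p + g i * (p - q).
  by rewrite mulrBl mulrBr addrA subrK.
apply: rpredD; last by apply: diag_powS; [exact: hg|exact: IH].
rewrite -[(size _).+1]/(2 + size s)%N; apply: diag_powM; first exact: hfg.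
by rewrite /p -[d]addr0 mulrC; apply: diag_pow_pr2M.
Qed.

End DiagonalPowers.

Section Derivations.
Variables (F : fieldType) (r : nat) (X : set 'rV[F]_r.+1).
Implicit Types (a b : reg X) (c : F) (x y : X).

Lemma reg_ext a b : (forall y, ev y a = ev y b) -> a = b.
Proof. by move=> ab; apply: val_inj; apply/funext. Qed.

Lemma fun2_ext (g h : fun2 X) : (forall x y, g (x, y) = h (x, y)) -> g = h.
Proof. by move=> gh; apply/funext => -[]. Qed.

Lemma ev_sum (I : Type) (l : seq I) (P : pred I) (f : I -> reg X) x :
  ev x (\sum_(i <- l | P i) f i) = \sum_(i <- l | P i) ev x (f i).
Proof. exact: (big_morph (fun a : reg X => ev x a)). Qed.

Lemma fun2_sum (I : Type) (l : seq I) (P : pred I) (f : I -> fun2 X) z :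
  (\sum_(i <- l | P i) f i) z = \sum_(i <- l | P i) f i z.
Proof. exact: (big_morph (fun g : fun2 X => g z)). Qed.

Lemma fun2_prod (I : Type) (l : seq I) (P : pred I) (f : I -> fun2 X) z :
  (\prod_(i <- l | P i) f i) z = \prod_(i <- l | P i) f i z.
Proof. exact: (big_morph (fun g : fun2 X => g z)). Qed.

Lemma fun2_exp (g : fun2 X) k z : (g ^+ k) z = g z ^+ k.
Proof. by elim: k => [|k IH]; rewrite ?expr0// !exprS -IH. Qed.

Lemma dif_eqP (g h : fun2 X) : g \in @diag_ideal F r X -> h \in @diag_ideal F r X ->
  cls (@diag_ideal F r X) (diag_pow X 0 2) g = cls (@diag_ideal F r X) (diag_pow X 0 2) h
  <-> g - h \in diag_pow X 0 2.
Proof. exact: cls_eqP. Qed.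

Lemma difD a b : dif (a + b) = dif a + dif b.
Proof.
rewrite /dif -clsD ?diff2_ideal//; congr cls; apply/funext => z.
by rewrite -[RHS]/((_ - _) + (_ - _)) addrACA -opprD.
Qed.

Lemma difM a b : dif (a * b) = a *: dif b + b *: dif a.
Proof.
rewrite /dif -clsZ ?diff2_ideal// -clsZ ?diff2_ideal// -clsD ?rpredZ ?diff2_ideal//.
apply/dif_eqP; [exact: diff2_ideal|by rewrite rpredD ?rpredZ ?diff2_ideal|].
rewrite (_ : _ - _ = diff2 a * diff2 b); last first.
  apply: fun2_ext => x y; rewrite /diff2.
  rewrite -[LHS]/(val a y * val b y - val a x * val b x -
    (val a x * (val b y - val b x) + val b x * (val a y - val a x))).
  rewrite -[RHS]/((val a y - val a x) * (val b y - val b x)).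
  by ring.
by apply: (@diag_powM _ _ _ 0 1 1); apply: diag_ideal_pow1; exact: diff2_ideal.
Qed.

Lemma dif_cst c : dif (cst_reg X c) = 0.
Proof.
apply/cls_eq0P; first exact: diff2_ideal.
suff -> : diff2 (cst_reg X c) = 0 by exact: rpred0.
by apply: fun2_ext => x y; rewrite /diff2/= subrr.
Qed.

Variables (n : nat) (s : 'I_n -> reg X).
Hypothesis hs : is_basis (fun i => dif (s i)).

Definition pderiv i a : reg X := coord (fun i => dif (s i)) (dif a) i.

Lemma pderivD i a b : pderiv i (a + b) = pderiv i a + pderiv i b.
Proof. by rewrite /pderiv difD -[dif a]scale1r coordP// mul1r scale1r. Qed.

Lemma pderivM i a b : pderiv i (a * b) = a * pderiv i b + b * pderiv i a.
Proof.
rewrite /pderiv difM coordP// -[b *: _]addr0 coordP//.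
have -> : coord (fun i => dif (s i)) 0 i = 0; last by rewrite addr0.
by apply: (@coord_uniq _ _ _ _ hs (fun=> 0)); rewrite big1// => j _; rewrite scale0r.
Qed.

Lemma pderiv_cst i c : pderiv i (cst_reg X c) = 0.
Proof.
rewrite /pderiv dif_cst; apply: (@coord_uniq _ _ _ _ hs (fun=> 0)).
by rewrite big1// => j _; rewrite scale0r.
Qed.

Lemma pderiv_basis i j : pderiv i (s j) = (i == j)%:R.
Proof. exact: (coord_basisE hs i j). Qed.

(* [vanish x k a] says that [a] lies in the k-th power of the maximal ideal at x,
   as tested by the derivatives of [a] of order less than [k]. *)
Fixpoint vanish x k a : Prop :=
  if k is k'.+1 then ev x a = 0 /\ forall i, vanish x k' (pderiv i a) else True.

Lemma vanishD x k a b : vanish x k a -> vanish x k b -> vanish x k (a + b).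
Proof.
elim: k a b => //= k IH a b [a0 ha] [b0 hb]; split.
  by rewrite -[LHS]/(ev x a + ev x b) a0 b0 addr0.
by move=> i; rewrite pderivD; exact: IH.
Qed.

Lemma vanishW x k a : vanish x k.+1 a -> vanish x k a.
Proof. by elim: k a => //= k IH a [a0 ha]; split=> // i; apply: IH. Qed.

Lemma vanish_mull x k a b : vanish x k a -> vanish x k (b * a).
Proof.
elim: k a b => // k IH a b ha; have [a0 da] := ha; split.
  by rewrite -[LHS]/(ev x b * ev x a) a0 mulr0.
move=> i; rewrite pderivM; apply: vanishD; first exact/IH/da.
by rewrite mulrC; exact/IH/vanishW.
Qed.

Lemma vanishS x k a b : ev x a = 0 -> vanish x k b -> vanish x k.+1 (a * b).
Proof.
elim: k a b => [|k IH] a b a0 hb; split.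
- by rewrite -[LHS]/(ev x a * ev x b) a0 mul0r.
- by [].
- by rewrite -[LHS]/(ev x a * ev x b) a0 mul0r.
move=> i; rewrite pderivM; apply: vanishD.
  by apply: IH => //; case: hb => _; apply.
by rewrite mulrC; exact: vanish_mull.
Qed.

Lemma vanish0 x k : vanish x k 0.
Proof.
elim: k => //= k IH; split=> // i; have := pderiv_cst i 0.
rewrite (_ : cst_reg X 0 = 0); last exact: reg_ext.
by move->.
Qed.

Lemma diag_pow_vanish x k g : g \in diag_pow X 0 k ->
  exists2 a, (forall y, ev y a = g (x, y)) & vanish x k a.
Proof.
have lin a (u v : fun2 X) (l m : reg X) :
    (forall y, ev y l = u (x, y)) -> (forall y, ev y m = v (x, y)) ->
    forall y, ev y (cst_reg X (ev x a) * l + m) = (a *: u + v) (x, y).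
  by move=> hl hm y; rewrite -[LHS]/(ev x a * ev y l + ev y m) hl hm.
elim: k g => [|k IH].
  apply: span_ind => [|a u v [l hl _] [m hm _]|_ [m _ <-]].
  - by exists 0.
  - by exists (cst_reg X (ev x a) * l + m) => //; exact: lin.
  - by exists m.
apply: diag_powS_ind => [|a u v [l hl vl] [m hm vm]|u v hu hv].
- by exists 0 => //; exact: vanish0.
- exists (cst_reg X (ev x a) * l + m); first exact: lin.
  by apply: vanishD => //; exact: vanish_mull.
have [b hb vb] := IH _ hv.
have [a ha _] : exists2 a, (forall y, ev y a = u (x, y)) & vanish x 0 a.
  case/andP: hu => hu _; move: u hu; apply: span_ind => [|a u w [l hl _] [m hm _]|_ [m _ <-]].
  - by exists 0.
  - by exists (cst_reg X (ev x a) * l + m) => //; exact: lin.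
  - by exists m.
exists (a * b); first by move=> y; rewrite -[LHS]/(ev y a * ev y b) ha hb.
by apply: vanishS => //; rewrite ha; case/andP: hu => _ /asboolP.
Qed.

Definition centred x y : 'I_n -> F := fun i => ev y (s i) - ev x (s i).

(* Taylor polynomials at [x] in the parameters [s i - s i (x)] are regular
   functions, differentiated formally by the [pderiv i]. *)
Lemma taylor_poly x (P : {mpoly F[n]}) : exists2 a,
  (forall y, ev y a = P.@[centred x y]) &
  (forall i y, ev y (pderiv i a) = (P^`M(i)).@[centred x y]).
Proof.
pose T Q := exists2 a, (forall y, ev y a = Q.@[centred x y]) &
  (forall i y, ev y (pderiv i a) = (Q^`M(i)).@[centred x y]).
have TC c : T c%:MP.
  exists (cst_reg X c) => [y|i y]; first by rewrite mevalC.
  by rewrite pderiv_cst mderivC meval0.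
have TD Q1 Q2 : T Q1 -> T Q2 -> T (Q1 + Q2).
  move=> [a ha da] [b hb db]; exists (a + b) => [y|i y].
    by rewrite mevalD -ha -hb.
  by rewrite pderivD mderivD mevalD -da -db.
have TM Q1 Q2 : T Q1 -> T Q2 -> T (Q1 * Q2).
  move=> [a ha da] [b hb db]; exists (a * b) => [y|i y].
    by rewrite mevalM -ha -hb.
  rewrite pderivM mderivM mevalD !mevalM -da -db -ha -hb addrC.
  by rewrite [ev y (pderiv i a) * _]mulrC.
have TX j : T 'X_j.
  exists (s j + cst_reg X (- ev x (s j))) => [y|i y]; first by rewrite mevalXU.
  rewrite pderivD pderiv_cst addr0 pderiv_basis mderivX mnm1E mevalZ mevalX.
  rewrite eq_sym; have [->|ij] := eqVneq j i; last by rewrite mul0r.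
  rewrite big1 ?mulr1// => l _.
  by rewrite mnmBE subnn expr0.
elim/mpolyind: P => [|c m p _ _ hp]; first by rewrite -mpolyC0; exact: TC.
apply: (TD) => //; rewrite -mul_mpolyC mpolyXE_id; apply: (TM) => //.
apply: big_ind => // [|i _]; first by rewrite -mpolyC1; exact: TC.
elim: (m i) => [|l IH]; first by rewrite expr0 -mpolyC1; exact: TC.
by rewrite exprS; exact: TM.
Qed.

Lemma meval_const (P : {mpoly F[n]}) : P.@[fun=> 0] = P@_0.
Proof.
elim/mpolyind: P => [|c m p _ _ IH]; first by rewrite meval0 mcoeff0.
rewrite mevalD mevalZ mevalX mcoeffD mcoeffZ mcoeffX IH; congr (_ * _ + _).
have [->|m0] := eqVneq m 0%MM; first by rewrite big1// => i _; rewrite mnm0E expr0.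
have [i mi] : exists i, m i != 0%N.
  apply/existsP; move: m0; apply: contraR; rewrite negb_exists => /forallP m0.
  by apply/eqP/mnmP => i; rewrite mnm0E; apply/eqP; rewrite -[_ == _]negbK.
by rewrite (bigD1 i)//= expr0n (negPf mi) mul0r.
Qed.

Hypothesis char0 : [pchar F] =i pred0.

Lemma taylor_poly_vanish x k a (P : {mpoly F[n]}) :
  (forall y, ev y a = P.@[centred x y]) -> vanish x k.+1 a ->
  forall m, (mdeg m <= k)%N -> P@_m = 0.
Proof.
have const b (Q : {mpoly F[n]}) :
    (forall y, ev y b = Q.@[centred x y]) -> ev x b = 0 -> Q@_0 = 0.
  move=> bE <-; rewrite -meval_const bE.
  by apply: meval_eq => i; rewrite /centred subrr.
elim: k a P => [|k IH] a P aE [a0 da] m mk.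
  by move: mk; rewrite leqn0 mdeg_eq0 => /eqP ->; exact: const a0.
have [->|m0] := eqVneq m 0%MM; first exact: const a0.
have [i mi] : exists i, m i != 0%N.
  apply/existsP; move: m0; apply: contraR; rewrite negb_exists => /forallP m0.
  by apply/eqP/mnmP => i; rewrite mnm0E; apply/eqP; rewrite -[_ == _]negbK.
have [b bE db] := taylor_poly x P.
have ab : a = b by apply: reg_ext => y; rewrite aE bE.
have mE : (m - U_(i) + U_(i))%MM = m by apply: submK; rewrite lep1mP.
have := IH (pderiv i a) (P^`M(i)) _ (da i) (m - U_(i))%MM.
rewrite mcoeff_mderiv mE -mulr_natr => H.
have /eqP : P@_m * ((m - U_(i))%MM i).+1%:R = 0.
  apply: H; first by move=> y; rewrite ab.
  by move: mk; rewrite -{1}mE mdegD mdeg1 addn1.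
by rewrite mulf_eq0 ((pcharf0P _).1 char0) orbF => /eqP.
Qed.

Definition monom (p : 'X_{1..n}) : fun2 X := \prod_i diff2 (s i) ^+ p i.

Lemma monom_free N m (c : 'X_{1..n < N} -> reg X) :
  \sum_p c p *: monom p \in diag_pow X 0 m -> forall p : 'X_{1..n < N}, (mdeg p < m)%N -> c p = 0.
Proof.
case: m => // m hc p pm; apply: reg_ext => x.
have [a aE va] := diag_pow_vanish x hc.
pose P : {mpoly F[n]} := \sum_(q : 'X_{1..n < N}) ev x (c q) *: 'X_[q].
have PE y : ev y a = P.@[centred x y].
  rewrite aE fun2_sum raddf_sum; apply: eq_bigr => q _.
  rewrite -[LHS]/(ev x (c q) * monom q (x, y)) /= mevalZ mevalX /monom fun2_prod.
  by congr (_ * _); apply: eq_bigr => i _; rewrite fun2_exp.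
have := taylor_poly_vanish PE va pm; rewrite raddf_sum (bigD1 p)//=.
rewrite mcoeffZ mcoeffX eqxx mulr1 big1 ?addr0// => q qp.
by rewrite mcoeffZ mcoeffX (_ : _ == _ = false) ?mulr0//; apply: negPf.
Qed.

End Derivations.

Section PrincipalPartsBasis.
Variables (F : fieldType) (r : nat) (X : set 'rV[F]_r.+1).
Variables (n : nat) (s : 'I_n -> reg X).
Hypothesis hs : is_basis (fun i => dif (s i)).
Implicit Types (g u v : fun2 X).

Lemma monom0 : monom s 0%MM = 1.
Proof. by rewrite /monom big1// => i _; rewrite mnm0E expr0. Qed.

Lemma monomS i (p : 'X_{1..n}) : diff2 (s i) * monom s p = monom s (U_(i) + p)%MM.
Proof.
rewrite /monom (bigD1 i)//= [in RHS](bigD1 i)//= mulrA mnmDE mnm1E eqxx -exprS.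
congr (_ * _); apply: eq_bigr => j /negPf ji.
by rewrite mnmDE mnm1E eq_sym ji.
Qed.

Lemma monom_pr2 (p : 'X_{1..n}) : monom s p \in @pr2 F r X 0.
Proof.
rewrite /monom; elim/big_ind: _ => [|u v hu hv|i _]; [exact: pr2_1|exact: (@pr2M _ _ _ 0 0)|].
elim: (p i) => [|l IH]; first by rewrite expr0 pr2_1.
by rewrite exprS; apply: (@pr2M _ _ _ 0 0) => //; apply: diag_ideal_pr2; exact: diff2_ideal.
Qed.

Lemma Omega_taylor u : u \in @diag_ideal F r X ->
  exists a : 'I_n -> reg X, u - \sum_i a i *: diff2 (s i) \in diag_pow X 0 2.
Proof.
move=> hu; pose om := cls (@diag_ideal F r X) (diag_pow X 0 2) u.
exists (coord (fun i => dif (s i)) om); apply/dif_eqP => //.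
  by rewrite rpred_sum// => i _; rewrite rpredZ ?diff2_ideal.
rewrite cls_sum; last by move=> i _; rewrite rpredZ ?diff2_ideal.
rewrite -[LHS]/om {1}(coord_sum hs om); apply: eq_bigr => i _.
by rewrite clsZ ?diff2_ideal.
Qed.

Lemma restrict_diag g : g \in @pr2 F r X 0 -> exists a, forall y : X, ev y a = g (y, y).
Proof.
move: g; apply: span_ind => [|a u v [b hb] [c hc]|_ [m _ <-]].
- by exists 0.
- by exists (a * b + c) => y; rewrite -[LHS]/(ev y a * ev y b + ev y c) hb hc.
- by exists m.
Qed.

Definition homog_span m := span [set g | exists2 p : 'X_{1..n}, mdeg p = m & g = monom s p].

Lemma homog_spanE m g : g \in homog_span m -> exists c : 'X_{1..n < m.+1} -> reg X,
  g = \sum_(p : 'X_{1..n < m.+1} | mdeg p == m) c p *: monom s p.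
Proof.
apply: span_sum => _ [p pm ->].
have pm' : (mdeg p < m.+1)%N by rewrite pm.
by exists (BMultinom pm'); rewrite /= ?pm.
Qed.

Lemma homog_spanS m i g : g \in homog_span m -> diff2 (s i) * g \in homog_span m.+1.
Proof.
move: g; apply: span_ind => [|a u v hu hv|_ [p pm ->]].
- by rewrite mulr0 rpred0.
- by rewrite mulrDr fun2_scalerAr rpredD ?rpredZ.
- by apply: mem_span; exists (U_(i) + p)%MM; rewrite ?monomS// mdegD mdeg1 pm.
Qed.

Lemma diag_pow_homog m g : g \in diag_pow X 0 m ->
  exists2 w, w \in homog_span m & g - w \in diag_pow X 0 m.+1.
Proof.
elim: m g => [|m IH] g.
  move=> hg; have [a aE] := restrict_diag hg.
  have h1 : 1 \in homog_span 0 by apply: mem_span; exists 0%MM; rewrite ?mdeg0 ?monom0.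
  exists (a *: (1 : fun2 X)); first by rewrite rpredZ.
  apply: diag_ideal_pow1; apply/andP; split; first by rewrite rpredB ?rpredZ ?pr2_1.
  apply/asboolP => y; rewrite -[LHS]/(g (y, y) - ev y a * 1) aE mulr1.
  exact: subrr.
move: g; apply: diag_powS_ind => [|a u v [w hw hu] [w' hw' hv]|u v hu hv].
- by exists 0; rewrite ?subrr ?rpred0.
- exists (a *: w + w'); first by rewrite rpredD ?rpredZ.
  by rewrite opprD addrACA -scalerBr rpredD ?rpredZ.
have [a ha] := Omega_taylor hu; have [w hw hvw] := IH _ hv.
set z := \sum_i _ in ha.
exists (z * w).
  rewrite mulr_suml rpred_sum// => i _; rewrite fun2_scalerAl rpredZ//.
  exact: homog_spanS.
have -> : u * v - z * w = (u - z) * v + z * (v - w).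
  by rewrite mulrBl mulrBr addrA subrK.
apply: rpredD; first exact: (diag_powM ha hv).
apply: diag_powS => //; rewrite rpred_sum// => i _.
by rewrite rpredZ ?diff2_ideal.
Qed.

Lemma pr2_taylor k g : g \in @pr2 F r X 0 -> exists c : 'X_{1..n < k.+1} -> reg X,
  g - \sum_p c p *: monom s p \in diag_pow X 0 k.+1.
Proof.
move=> hg; suff [w hw hgw] : exists2 w,
    w \in span (range (fun p : 'X_{1..n < k.+1} => monom s p)) &
    g - w \in diag_pow X 0 k.+1.
  have [_ [p _ <-]|c cE] := span_sum (P := predT) (e := fun p : 'X_{1..n < k.+1} => monom s p) _ hw.
    by exists p.
  by exists c; rewrite -cE.
have homog_sub m w : (m <= k)%N -> w \in homog_span m ->
    w \in span (range (fun p : 'X_{1..n < k.+1} => monom s p)).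
  move=> mk; move: w; apply: span_ind => [|a u v hu hv|_ [p pm ->]].
  - exact: rpred0.
  - by rewrite rpredD ?rpredZ.
  - have pk : (mdeg p < k.+1)%N by rewrite pm.
    by apply: mem_span; exists (BMultinom pk).
suff H m : (m <= k.+1)%N -> exists2 w,
    w \in span (range (fun p : 'X_{1..n < k.+1} => monom s p)) &
    g - w \in diag_pow X 0 m by exact: H.
elim: m => [_|m IH mk]; first by exists 0; rewrite ?rpred0 ?subr0.
have [w hw /diag_pow_homog[w' hw' hg']] := IH (ltnW mk).
exists (w + w'); last by rewrite opprD addrA.
by rewrite rpredD// (homog_sub m).
Qed.

Hypothesis char0 : [pchar F] =i pred0.

Lemma PP_basis k :
  is_basis (fun p : 'X_{1..n < k.+1} => PP_cls 0 k (\prod_i diff2 (s i) ^+ p i)).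
Proof.
have sumE (c : 'X_{1..n < k.+1} -> reg X) :
    PP_cls 0 k (\sum_p c p *: monom s p) =
    \sum_p c p *: PP_cls 0 k (\prod_i diff2 (s i) ^+ p i).
  rewrite /PP_cls cls_sum; last by move=> p _; rewrite rpredZ ?monom_pr2.
  by apply: eq_bigr => p _; rewrite clsZ ?monom_pr2.
have mem (c : 'X_{1..n < k.+1} -> reg X) : \sum_p c p *: monom s p \in @pr2 F r X 0.
  by rewrite rpred_sum// => p _; rewrite rpredZ ?monom_pr2.
apply: is_basisP => [v|c].
  have [g hg ->] := cls_surj v; have [c hc] := pr2_taylor k hg.
  by exists c; rewrite -sumE; apply/cls_eqP.
rewrite -sumE => /cls_eq0P => /(_ (mem c)) c0 p.
by apply: (monom_free hs char0 c0); exact: bmdeg.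
Qed.

Lemma Dop_taylor k (e : sect 0 X) :
  pull2 e - \sum_(p : 'X_{1..n < k.+1}) Dop s p e *: monom s p \in diag_pow X 0 k.+1.
Proof.
have mem (c : 'X_{1..n < k.+1} -> reg X) : \sum_p c p *: monom s p \in @pr2 F r X 0.
  by rewrite rpred_sum// => p _; rewrite rpredZ ?monom_pr2.
apply/(@cls_eqP _ _ (@pr2 F r X 0)); [exact: pull2_mem|exact: mem|].
rewrite cls_sum; last by move=> p _; rewrite rpredZ ?monom_pr2.
rewrite -[LHS]/(dprin k e) {1}(coord_sum (@PP_basis k) (dprin k e)).
by apply: eq_bigr => p _; rewrite clsZ ?monom_pr2.
Qed.

End PrincipalPartsBasis.

Section FundamentalForm.
Variables (F : fieldType) (r : nat) (X : set 'rV[F]_r.+1).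
Implicit Types (a : reg X) (g u v : fun2 X) (l : sect 1 X).

Lemma PP_cls_eqP d k g h : g \in @pr2 F r X d -> h \in @pr2 F r X d ->
  PP_cls d k g = PP_cls d k h <-> g - h \in diag_pow X d k.+1.
Proof. exact: cls_eqP. Qed.

Lemma PP_cls_eq0P d k g : g \in @pr2 F r X d ->
  PP_cls d k g = 0 <-> g \in diag_pow X d k.+1.
Proof. exact: cls_eq0P. Qed.

Lemma diag_pow_prod_pred (I : finType) (P : pred I) (u : I -> fun2 X) :
  (forall i, P i -> u i \in @diag_ideal F r X) ->
  \prod_(i | P i) u i \in diag_pow X 0 #|P|.
Proof.
move=> hu; have -> : \prod_(i | P i) u i = \prod_(i <- enum P) u i by rewrite big_enum.
rewrite cardE -(big_map u predT id) -(size_map u).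
apply: diag_pow_prod => _ /mapP[i + ->].
by rewrite mem_enum => /hu.
Qed.

Lemma diag_pow_prod_ord k (u : 'I_k -> fun2 X) :
  (forall i, u i \in @diag_ideal F r X) -> \prod_i u i \in diag_pow X 0 k.
Proof.
move=> hu; have := @diag_pow_prod_pred _ predT u (fun i _ => hu i).
by rewrite (_ : #|_| = k)// -[RHS]card_ord; apply: eq_card.
Qed.

Section Theta.
Variables (k : nat) (l : sect 1 X).

Let phi (w : {ffun 'I_k -> Omega X}) : PP X 1 k :=
  PP_cls 1 k ((\prod_j (subrep (w j) : fun2 X)) * pull2 l).

Let subrepI (w : Omega X) : subrep w \in @diag_ideal F r X.
Proof. exact: subrep_mem. Qed.

Let prodI (w : {ffun 'I_k -> Omega X}) :
  (\prod_j (subrep (w j) : fun2 X)) * pull2 l \in @pr2 F r X 1.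
Proof.
apply: (diag_pow_pr2 (k := k)); apply: (@diag_pow_twist _ _ _ 0 1).
by apply: diag_pow_prod_ord => j; exact: subrepI.
Qed.

Let phi_slot w j a (u v : Omega X) :
  phi (slot w j (a *: u + v)) = a *: phi (slot w j u) + phi (slot w j v).
Proof.
rewrite /phi /PP_cls -clsP ?prodI//.
apply/PP_cls_eqP; [exact: prodI|by rewrite rpredD ?rpredZ ?prodI|].
pose q := (\prod_(i | i != j) (subrep (w i) : fun2 X)) * pull2 l.
have E z : (\prod_i (subrep (slot w j z i) : fun2 X)) * pull2 l = subrep z * q.
  rewrite (bigD1 j)//= ffunE eqxx -mulrA; congr (_ * (_ * _)).
  by apply: eq_bigr => i /negPf ij; rewrite ffunE ij.
rewrite !E -fun2_scalerAl -mulrDl -mulrBl.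
have qI : q \in diag_pow X 1 k.-1.
  apply: (@diag_pow_twist _ _ _ 0 1).
  have <- : #|predC1 j| = k.-1 by rewrite cardC1 card_ord.
  by apply: diag_pow_prod_pred => i _; exact: subrepI.
have k0 : (0 < k)%N by exact: leq_ltn_trans (leq0n j) (ltn_ord j).
rewrite -(prednK k0) -[k.-1.+2]/(2 + k.-1)%N; apply: diag_powM => //.
exact: subrepP.
Qed.

Let phi_perm (w : {ffun 'I_k -> Omega X}) (s : 'S_k) : phi [ffun j => w (s j)] = phi w.
Proof.
rewrite /phi; congr (PP_cls _ _ (_ * _)).
rewrite [RHS](reindex_inj (@perm_inj _ s))/=.
by apply: eq_bigr => j _; rewrite ffunE.
Qed.

Lemma theta_symprod w : theta (symprod w) l =
  PP_cls 1 k ((\prod_j (subrep (w j) : fun2 X)) * pull2 l).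
Proof. exact: (@sym_lift_symprod _ _ _ _ _ id phi). Qed.

Lemma thetaP a (w w' : Sym k (Omega X)) : theta (a *: w + w') l = a *: theta w l + theta w' l.
Proof. exact: (@sym_liftP _ _ _ _ _ id phi). Qed.

Lemma theta_sum (I : Type) (z : seq I) (P : pred I) (c : I -> reg X) (f : I -> Sym k (Omega X)) :
  theta (\sum_(i <- z | P i) c i *: f i) l = \sum_(i <- z | P i) c i *: theta (f i) l.
Proof. exact: (@sym_lift_sum _ _ _ _ _ id phi). Qed.

Lemma theta0 : theta (0 : Sym k (Omega X)) l = 0.
Proof. exact: (@sym_lift0 _ _ _ _ _ id phi). Qed.

End Theta.

Lemma theta_scale k (w : Sym k (Omega X)) a l : theta w (a *: l) = a *: theta w l.
Proof.
move: w; apply: sym_ind => [|b u v hu hv|w].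
- by rewrite !theta0 scaler0.
- by rewrite !thetaP hu hv scalerDr !scalerA mulrC.
rewrite !theta_symprod.
have wI : \prod_j (subrep (w j) : fun2 X) \in diag_pow X 0 k.
  by apply: diag_pow_prod_ord => j; exact: subrep_mem.
have wl (m : sect 1 X) : (\prod_j (subrep (w j) : fun2 X)) * pull2 m \in @pr2 F r X 1.
  by apply: (diag_pow_pr2 (k := k)); exact: (@diag_pow_twist _ _ _ 0 1).
rewrite /PP_cls -clsZ//; apply/PP_cls_eqP; rewrite ?rpredZ//.
set u := \prod_j _; rewrite -fun2_scalerAr -mulrBr.
rewrite (_ : pull2 (a *: l) - a *: pull2 l = diff2 a * pull2 l); last first.
  apply: fun2_ext => x y.
  rewrite -[LHS]/(val a y * val l y - val a x * val l y).
  by rewrite -[RHS]/((val a y - val a x) * val l y) mulrBl.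
rewrite mulrA -[k.+1]addn1; apply: (@diag_pow_twist _ _ _ 0 1).
by apply: diag_powM => //; apply: diag_ideal_pow1; exact: diff2_ideal.
Qed.

Variables (n : nat) (s : 'I_n -> reg X).
Hypothesis hs : is_basis (fun i => dif (s i)).

Lemma prod_m2s (R : comPzRingType) (f : 'I_n -> R) (p : 'X_{1..n}) :
  \prod_(i <- m2s p) f i = \prod_i f i ^+ p i.
Proof.
rewrite /m2s big_flatten big_map big_enum/=; apply: eq_bigr => i _.
by rewrite big_nseq iter_mulr_1.
Qed.

Lemma theta_monomial k (p : 'X_{1..n}) l : mdeg p = k ->
  theta (sym_monomial k (fun i => dif (s i)) p) l = PP_cls 1 k (monom s p * pull2 l).
Proof.
move=> pk; rewrite theta_symprod.
set P := \prod_j _.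
have -> : P = \prod_(i <- m2s p) (subrep (dif (s i)) : fun2 X).
  rewrite -(big_map (fun i => dif (s i)) predT (fun w => subrep w : fun2 X)).
  rewrite (big_nth 0) big_mkord size_map size_m2s pk.
  by apply: eq_bigr => j _; rewrite ffunE.
rewrite /monom -prod_m2s.
have memp (f : 'I_n -> fun2 X) : (forall i, f i \in @diag_ideal F r X) ->
    \prod_(i <- m2s p) f i * pull2 l \in @pr2 F r X 1.
  move=> hf; apply: (diag_pow_pr2 (k := k)); apply: (@diag_pow_twist _ _ _ 0 1).
  rewrite -pk -size_m2s -(big_map f predT id) -(size_map f).
  by apply: diag_pow_prod => _ /mapP[i _ ->].
have hI i : subrep (dif (s i)) \in @diag_ideal F r X by exact: subrep_mem.
apply/PP_cls_eqP; [exact: memp|by apply: memp => i; exact: diff2_ideal|].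
apply: diag_pow_sub_prod => [||i _|i _|i _].
- by rewrite size_m2s.
- exact: pull2_mem.
- exact: hI.
- exact: diff2_ideal.
- by apply: subrep_cls; exact: diff2_ideal.
Qed.

Lemma theta_monomials k (c : 'X_{1..n < k.+1} -> reg X) l :
  theta (\sum_(p : 'X_{1..n < k.+1} | mdeg p == k)
           c p *: sym_monomial k (fun i => dif (s i)) p) l =
  PP_cls 1 k ((\sum_(p : 'X_{1..n < k.+1} | mdeg p == k) c p *: monom s p) * pull2 l).
Proof.
have mem (p : 'X_{1..n < k.+1}) : monom s p * pull2 l \in @pr2 F r X 1.
  by apply: (@pr2M _ _ _ 0 1); [exact: monom_pr2|exact: pull2_mem].
rewrite theta_sum mulr_suml /PP_cls cls_sum; last first.
  by move=> p _; rewrite fun2_scalerAl rpredZ.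
apply: eq_bigr => p /eqP pk; rewrite theta_monomial//.
by rewrite fun2_scalerAl clsZ.
Qed.

Lemma sym_monomialsE k (w : Sym k (Omega X)) :
  exists c : 'X_{1..n < k.+1} -> reg X, w = \sum_(p : 'X_{1..n < k.+1} | mdeg p == k)
    c p *: sym_monomial k (fun i => dif (s i)) p.
Proof.
apply: (span_sum _ (sym_span_monomials (k := k) hs w)) => _ [p pm ->].
have pm' : (mdeg p < k.+1)%N by rewrite pm.
by exists (BMultinom pm'); rewrite /= ?pm.
Qed.

Variables (t0 : sect 1 X) (l0 : sect (-1) X).
Hypothesis l0t0 : pairing l0 t0 = 1.

Lemma l0t0E (y : X) : val l0 y * val t0 y = 1.
Proof. by rewrite -[LHS]/(val (pairing l0 t0) y) l0t0. Qed.

Lemma sect1E l : l = pairing l0 l *: t0.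
Proof.
apply: val_inj; apply/funext => y.
by rewrite -[RHS]/(val l0 y * val l y * val t0 y) mulrAC l0t0E mul1r.
Qed.

Lemma diag_pow_untwist k g :
  g * pull2 t0 \in diag_pow X 1 k <-> g \in diag_pow X 0 k.
Proof.
split=> [h|]; last exact: (@diag_pow_twist _ _ _ 0 1).
rewrite (_ : g = g * pull2 t0 * pull2 l0).
  exact: (@diag_pow_twist _ _ _ 1 (-1)).
apply: fun2_ext => x y; rewrite -[RHS]/(g (x, y) * val t0 y * val l0 y).
by rewrite -mulrA [val t0 y * _]mulrC l0t0E mulr1.
Qed.

Hypothesis char0 : [pchar F] =i pred0.

Lemma theta_inj k (w : Sym k (Omega X)) : theta w t0 = 0 -> w = 0.
Proof.
have [c ->] := sym_monomialsE w; rewrite theta_monomials.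
set g := \sum_(p | _) _ => /PP_cls_eq0P.
have hg : g \in @pr2 F r X 0.
  by rewrite rpred_sum// => p _; rewrite rpredZ ?monom_pr2.
move=> /(_ (@pr2M _ _ _ 0 1 _ _ hg (pull2_mem t0))) /diag_pow_untwist.
pose c' (p : 'X_{1..n < k.+1}) : reg X := if mdeg p == k then c p else 0.
have -> : g = \sum_p c' p *: monom s p.
  rewrite /g big_mkcond; apply: eq_bigr => p _; rewrite /c'.
  by case: ifP => // _; rewrite scale0r.
move=> /(monom_free hs char0) c0; rewrite big1// => p pk.
by have := c0 p (bmdeg p); rewrite /c' pk => ->; rewrite scale0r.
Qed.

Lemma theta_injective k : injective (fun w : Sym k (Omega X) => theta w t0).
Proof.
move=> w w' /= e; apply/eqP; rewrite -subr_eq0; apply/eqP; apply: theta_inj.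
by rewrite addrC -scaleN1r thetaP e scaleN1r addNr.
Qed.

Definition Taylor (v : VO X) : fun2 X :=
  \sum_j (v j : reg X) *: (pull2 (linform X (delta_mx j 0)) : fun2 X).

Lemma Taylor_pr2 (v : VO X) : Taylor v \in @pr2 F r X 1.
Proof. by rewrite rpred_sum// => j _; rewrite rpredZ ?pull2_mem. Qed.

Lemma alphaE k (v : VO X) : alpha k v = PP_cls 1 k (Taylor v).
Proof.
rewrite /PP_cls cls_sum; last by move=> j _; rewrite rpredZ ?pull2_mem.
by apply: eq_bigr => j _; rewrite clsZ ?pull2_mem.
Qed.

Lemma alphaP k a (v w : VO X) : alpha k (a *: v + w) = a *: alpha k v + alpha k w.
Proof.
rewrite /alpha scaler_sumr -big_split/=; apply: eq_bigr => j _.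
by rewrite !ffunE scalerDl scalerA.
Qed.

Lemma alpha0 k : alpha k (0 : VO X) = 0.
Proof. by rewrite /alpha big1// => j _; rewrite ffunE scale0r. Qed.

Lemma alpha_eq0P k (v : VO X) : alpha k v = 0 <-> Taylor v \in diag_pow X 1 k.+1.
Proof. by rewrite alphaE; apply: PP_cls_eq0P; exact: Taylor_pr2. Qed.

Lemma twistP a (xi xi' : VLd X) l : twist (a *: xi + xi') l = a *: twist xi l + twist xi' l.
Proof.
apply/ffunP => j; rewrite !ffunE; apply: reg_ext => y.
rewrite -[LHS]/((val a y * val (xi j) y + val (xi' j) y) * val l y).
rewrite -[RHS]/(val a y * (val (xi j) y * val l y) + val (xi' j) y * val l y).
by rewrite mulrDl -mulrA.
Qed.

Lemma twist0 l : twist (0 : VLd X) l = 0.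
Proof. by apply/ffunP => j; rewrite !ffunE; apply: val_inj; rewrite /= mul0r. Qed.

Lemma twist_scale a xi l : twist xi (a *: l) = a *: twist xi l.
Proof.
apply/ffunP => j; rewrite !ffunE; apply: reg_ext => y.
rewrite -[LHS]/(val (xi j) y * (val a y * val l y)).
by rewrite -[RHS]/(val a y * (val (xi j) y * val l y)) mulrCA.
Qed.

Lemma Rk_twist k xi : xi \in @Rk F r X k -> forall l, alpha k (twist xi l) = 0.
Proof.
move=> + l; move: xi; apply: span_ind => [|a u v hu hv|_ [v [l' [v0 ->]]]].
- by rewrite twist0 alpha0.
- by rewrite twistP alphaP hu hv scaler0 addr0.
have -> : twist [ffun j => (v j : reg X) *: l'] l = pairing l' l *: v.
  apply/ffunP => j; rewrite !ffunE; apply: reg_ext => y.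
  rewrite -[LHS]/(val (v j : reg X) y * val l' y * val l y).
  by rewrite -[RHS]/(val l' y * val l y * val (v j : reg X) y) -mulrA mulrC.
by rewrite -[_ *: v]addr0 alphaP alpha0 v0 scaler0 addr0.
Qed.

Lemma alpha_theta k (v : VO X) : alpha k.-1 v = 0 -> (0 < k)%N ->
  exists w : Sym k (Omega X), alpha k v = theta w t0.
Proof.
move=> /alpha_eq0P hv k0; rewrite prednK// in hv.
pose g := Taylor v * pull2 l0.
have gE : Taylor v = g * pull2 t0.
  apply: fun2_ext => x y; rewrite -[RHS]/(Taylor v (x, y) * val l0 y * val t0 y).
  by rewrite -mulrA l0t0E mulr1.
have hg : g \in diag_pow X 0 k by apply/diag_pow_untwist; rewrite -gE.
have [w /homog_spanE[c cE] hw] := diag_pow_homog hs hg.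
exists (\sum_(p : 'X_{1..n < k.+1} | mdeg p == k)
          c p *: sym_monomial k (fun i => dif (s i)) p).
rewrite theta_monomials -cE alphaE gE.
have wm : w \in @pr2 F r X 0.
  by rewrite cE rpred_sum// => p _; rewrite rpredZ ?monom_pr2.
apply/PP_cls_eqP.
- by rewrite -gE Taylor_pr2.
- exact: (@pr2M _ _ _ 0 1 _ _ wm (pull2_mem t0)).
- by rewrite -mulrBl; apply/diag_pow_untwist.
Qed.

Lemma fund_unique k (xi : submod (@Rk F r X k.-1)) w :
  alpha k (twist (val xi) t0) = theta w t0 -> fund xi = w.
Proof.
move=> wE; rewrite /fund; case: xgetP => [w' _ /(_ t0) w'E|no].
  by apply: theta_injective; rewrite /= -w'E.
case: (no w) => l.
by rewrite (sect1E l) twist_scale theta_scale -[_ *: twist _ _]addr0 alphaP alpha0 addr0 wE.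
Qed.

Lemma fundE k (xi : submod (@Rk F r X k.-1)) : (0 < k)%N ->
  alpha k (twist (val xi) t0) = theta (fund xi) t0.
Proof.
move=> k0; have [|w wE] := @alpha_theta k (twist (val xi) t0) _ k0.
  by apply: Rk_twist; exact: valP.
by rewrite (fund_unique wE).
Qed.

Lemma fundP k a (xi xi' : submod (@Rk F r X k.-1)) : (0 < k)%N ->
  fund (a *: xi + xi') = a *: fund xi + fund xi'.
Proof.
move=> k0; apply: fund_unique.
by rewrite linearP twistP alphaP thetaP !fundE.
Qed.

End FundamentalForm.

Section AmbientCoordinates.
Variables (F : fieldType) (r : nat).
Implicit Types X U : set 'rV[F]_r.+1.

Lemma TaylorP X a (v w : VO X) : Taylor (a *: v + w) = a *: Taylor v + Taylor w.
Proof.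
rewrite /Taylor scaler_sumr -big_split/=; apply: eq_bigr => j _.
by rewrite !ffunE scalerDl scalerA.
Qed.

Lemma Taylor0 X : Taylor (0 : VO X) = 0.
Proof. by rewrite /Taylor big1// => j _; rewrite ffunE scale0r. Qed.

Lemma TaylorZ X a (v : VO X) : Taylor (a *: v) = a *: Taylor v.
Proof. by rewrite -[a *: v]addr0 TaylorP Taylor0 addr0. Qed.

Lemma TaylorB X (v w : VO X) : Taylor (v - w) = Taylor v - Taylor w.
Proof. by rewrite addrC -scaleN1r TaylorP scaleN1r addrC. Qed.

Lemma Taylor_sum X (I : Type) (l : seq I) (c : I -> reg X) (v : I -> VO X) :
  Taylor (\sum_(i <- l) c i *: v i) = \sum_(i <- l) c i *: Taylor (v i).
Proof.
elim/big_rec2: _ => [|i y x _ <-]; [exact: Taylor0|exact: TaylorP].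
Qed.

Lemma Taylor_tens X T a : Taylor (tens T a) = a *: (pull2 (linform X T) : fun2 X).
Proof.
apply: fun2_ext => x y; rewrite /Taylor fun2_sum.
rewrite -[RHS]/(val a x * (val y *m T) 0 0) mxE mulr_sumr.
apply: eq_bigr => j _; rewrite ffunE.
rewrite -[LHS]/(T j 0 * val a x * (val y *m delta_mx j 0) 0 0) mxE (bigD1 j)//=.
rewrite mxE !eqxx mulr1 big1 ?addr0; last first.
  by move=> i /negPf ij; rewrite mxE ij mulr0.
by rewrite mulrCA mulrA mulrAC mulrC mulrA.
Qed.

(* The section of V (x) O with values T_i - t_i T_0, paired with g. *)
Definition affine_dual X (T : 'I_r.+1 -> 'cV[F]_r.+1) (t g : 'I_r -> reg X) : VO X :=
  \sum_i g i *: (tens (T (lift ord0 i)) 1 - tens (T ord0) (t i)).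

Lemma Taylor_affine_dual X T (t g : 'I_r -> reg X) :
  (forall i, linform X (T (lift ord0 i)) = t i *: linform X (T ord0)) ->
  Taylor (affine_dual T t g) =
  (\sum_i g i *: diff2 (t i)) * pull2 (linform X (T ord0)).
Proof.
move=> tT; rewrite Taylor_sum mulr_suml; apply: eq_bigr => i _.
rewrite fun2_scalerAl TaylorB !Taylor_tens tT scale1r; congr (_ *: _).
apply: fun2_ext => x y; rewrite [RHS]mulrBl.
by [].
Qed.

Section Trivialization.
Variables (U : set 'rV[F]_r.+1) (T : 'I_r.+1 -> 'cV[F]_r.+1) (t : 'I_r -> reg U).
Hypotheses (hU : proj_open U) (hT : adapted T t).

Lemma proj_open_neq0 (u : U) : val u != 0.
Proof.
have [Z _ UE] := hU; have := set_mem (valP u).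
by rewrite [X in X _]UE => -[].
Qed.

Lemma adapted_T0_neq0 (u : U) : val (linform U (T ord0)) u != 0.
Proof.
have [j uj] := rV0Pn _ (proj_open_neq0 u).
have [_ gen _ _] := hT; have [a [aE _]] := gen (linform U (delta_mx j 0)).
have uE : val (linform U (delta_mx j 0)) u = val a u * val (linform U (T ord0)) u.
  by rewrite aE.
apply: contraNneq uj => T0; move: uE; rewrite T0 mulr0.
rewrite -[LHS]/((val u *m delta_mx j 0) 0 0) mxE (bigD1 j)//= mxE !eqxx mulr1.
by rewrite big1 ?addr0 => [->//|i /negPf ij]; rewrite mxE ij mulr0.
Qed.

Variables (X : set 'rV[F]_r.+1) (hXU : X `<=` U).

Lemma T0_inv_section :
  (fun y : X => (val (linform X (T ord0)) y)^-1) \in @section_pred F r (-1) X.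
Proof.
apply/section_predP => x _.
have qE (y : X) : (\sum_j T ord0 j 0 *: 'X_j : {mpoly F[r.+1]}).@[val y 0] =
    val (linform X (T ord0)) y.
  rewrite -[RHS]/((val y *m T ord0) 0 0) mxE raddf_sum/=.
  by apply: eq_bigr => j _; rewrite mevalZ mevalXU mulrC.
exists 0%N, 1%N, 1, (\sum_j T ord0 j 0 *: 'X_j); split.
- exact: dhomog1.
- by apply: rpred_sum => j _; apply: dhomogZ; rewrite dhomogX; apply/eqP/mdeg1.
- by [].
- by rewrite qE; exact: (adapted_T0_neq0 (inclusion hXU x)).
- by move=> y _; rewrite qE meval1 div1r.
Qed.

Lemma t0dualP : pairing (t0dual X T) (linform X (T ord0)) = 1.
Proof.
rewrite /t0dual; case: xgetP => [l _ //|no].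
case: (no (exist (fun f => f \in @section_pred F r (-1) X) _ T0_inv_section)).
apply: val_inj; apply/funext => y.
rewrite -[LHS]/((val (linform X (T ord0)) y)^-1 * val (linform X (T ord0)) y).
by rewrite mulVf//; exact: (adapted_T0_neq0 (inclusion hXU y)).
Qed.

Lemma linform_restrict i :
  linform X (T (lift ord0 i)) = restrict hXU (t i) *: linform X (T ord0).
Proof.
have [_ _ tT _] := hT; apply: val_inj; apply/funext => y.
exact: (congr1 (fun m : sect 1 U => val m (inclusion hXU y)) (tT i)).
Qed.

Lemma conormal_cls_partial f i : f \in ideal_of hXU ->
  restrict hXU (partial t (subrep (conormal_cls hXU f)) i) = restrict hXU (partial t f i).
Proof.
move=> hf; have [_ _ _ ht] := hT.
have hsq (g : reg U) : g \in ideal_sq hXU ->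
    restrict hXU g = 0 /\ restrict hXU (pderiv t i g) = 0.
  have comb (a u v : reg U) : restrict hXU u = 0 -> restrict hXU v = 0 ->
      restrict hXU (a * u + v) = 0.
    move=> u0 v0; rewrite (_ : restrict _ _ = restrict hXU a * restrict hXU u + restrict hXU v).
      by rewrite u0 v0 mulr0 addr0.
    exact: reg_ext.
  have combM (u v w z : reg U) : restrict hXU u = 0 -> restrict hXU v = 0 ->
      restrict hXU (w * u + z * v) = 0.
    move=> u0 v0; apply: (comb) => //; rewrite -[_ * v]addr0; apply: (comb) => //.
    exact: reg_ext.
  move: g; apply: (@span_ind (reg U) (reg U)^o _ (fun g => restrict hXU g = 0 /\
    restrict hXU (pderiv t i g) = 0)) => [|a u v [u0 du0] [v0 dv0]|_ [u hu [v hv ->]]].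
  - have E0 : 0 = cst_reg U 0 :> reg U by exact: reg_ext.
    by rewrite E0 pderiv_cst//; split; exact: reg_ext.
  - split; first exact: (comb).
    rewrite -[a *: u]/(a * u) pderivD// pderivM//.
    by rewrite -addrA [u * _]mulrC; apply: (comb) => //; exact: (comb).
  - have /eqP u0 : restrict hXU u == 0 by exact: hu.
    have /eqP v0 : restrict hXU v == 0 by exact: hv.
    rewrite pderivM//; split; first by rewrite -[_ * v]addr0; apply: (comb) => //; exact: reg_ext.
    by rewrite mulrC [v * _]mulrC; apply: combM.
have /hsq[_ d0] := subrep_cls (ideal_sq hXU) hf.
set f' := subrep _ in d0 *.
rewrite -[LHS]/(restrict hXU (pderiv t i f')) -[RHS]/(restrict hXU (pderiv t i f)).
pose g : reg U := f' - f.
have -> : pderiv t i f' = pderiv t i g + pderiv t i f by rewrite -pderivD// subrK.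
apply: reg_ext => y.
rewrite -[LHS]/(ev y (restrict hXU (pderiv t i g)) + ev y (restrict hXU (pderiv t i f))).
by rewrite d0 add0r.
Qed.

Lemma incl_t0E f : f \in ideal_of hXU ->
  incl_t0 T t (conormal_cls hXU f) = affine_dual T (fun i => restrict hXU (t i))
    (fun i => restrict hXU (partial t f i)).
Proof.
by move=> hf; apply: eq_bigr => i _; rewrite conormal_cls_partial.
Qed.

End Trivialization.

(* The Euler sequence: V (x) O -> P^1(O(1)) is injective on P^r. *)
Lemma alpha1_inj U (T : 'I_r.+1 -> 'cV[F]_r.+1) (t : 'I_r -> reg U) (v : VO U) :
  proj_open U -> adapted T t -> alpha 1 v = 0 -> v = 0.
Proof.
move=> hU hT /alpha_eq0P hv; have [bT gen tT ht] := hT.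
pose C j m := coord T (delta_mx j 0) m.
have CE j l : \sum_m C j m * T m l 0 = (l == j)%:R.
  have := congr1 (fun c : 'cV_r.+1 => c l 0) (coord_sum bT (delta_mx j 0)).
  rewrite summxE mxE eqxx andbT => ->.
  by apply: eq_bigr => m _; rewrite mxE.
pose b m : reg U := \sum_j cst_reg U (C j m) * (v j : reg U).
have vE : v = \sum_m 1 *: tens (T m) (b m).
  apply/ffunP => l; apply: reg_ext => x.
  rewrite sum_ffunE ev_sum.
  transitivity (\sum_j (\sum_m C j m * T m l 0) * ev x (v j : reg U)).
    rewrite (bigD1 l)//= CE eqxx mul1r big1 ?addr0// => j /negPf jl.
    by rewrite CE eq_sym jl mul0r.
  under eq_bigr do rewrite mulr_suml.
  rewrite exchange_big; apply: eq_bigr => m _; rewrite scale1r ffunE.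
  rewrite -[RHS]/(T m l 0 * ev x (b m)) ev_sum mulr_sumr; apply: eq_bigr => j _.
  rewrite -[ev x (cst_reg U _ * _)]/(C j m * ev x (v j : reg U)).
  by rewrite mulrA [T m l 0 * _]mulrC.
pose q : fun2 U := b ord0 *: (1 : fun2 U) +
   \sum_i b (lift ord0 i) *: (pull2 (t i : sect 0 U) : fun2 U).
have TE : Taylor v = q * pull2 (linform U (T ord0)).
  rewrite vE Taylor_sum big_ord_recl !scale1r Taylor_tens mulrDl mulr_suml.
  rewrite fun2_scalerAl mul1r; congr (_ + _); apply: eq_bigr => i _.
  by rewrite scale1r Taylor_tens tT fun2_scalerAl.
have hXU : U `<=` U by [].
have hq : q \in diag_pow U 0 2.
  by apply/(diag_pow_untwist (t0dualP hU hT hXU)); rewrite -TE.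
have b0 : b ord0 = - \sum_i b (lift ord0 i) * t i.
  apply: reg_ext => x; have /andP[_ /asboolP q0] := diag_powS_ideal hq.
  have := q0 x; rewrite -[q (x, x)]/(ev x (b ord0) * 1 + _) fun2_sum mulr1.
  move=> /eqP; rewrite addr_eq0 => /eqP ->.
  by rewrite -[RHS]/(- ev x _) ev_sum.
have qE : q = \sum_i b (lift ord0 i) *: diff2 (t i).
  apply: fun2_ext => x y; rewrite fun2_sum.
  rewrite -[LHS]/(ev x (b ord0) * 1 + _) fun2_sum mulr1 b0.
  rewrite -[ev x (- _)]/(- ev x _) ev_sum addrC -sumrB; apply: eq_bigr => i _.
  rewrite -[LHS]/(ev x (b (lift ord0 i)) * ev y (t i) - ev x (b (lift ord0 i)) * ev x (t i)).
  by rewrite -mulrBr.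
have hb : \sum_i b (lift ord0 i) *: dif (t i) = 0.
  have mem i : diff2 (t i) \in @diag_ideal F r U := diff2_ideal _.
  transitivity (cls (@diag_ideal F r U) (diag_pow U 0 2) q).
    rewrite qE cls_sum; last by move=> i _; rewrite rpredZ.
    by apply: eq_bigr => i _; rewrite clsZ.
  by apply/cls_eq0P => //; exact: diag_powS_ideal hq.
have bi i : b (lift ord0 i) = 0 := is_basis_free ht hb i.
have {}b0 : b ord0 = 0.
  by rewrite b0 big1 ?oppr0// => i _; rewrite bi mul0r.
rewrite vE big_ord_recl b0 big1 => [|i _].
  apply/ffunP => j; rewrite !ffunE addr0 mulr0.
  exact: scaler0.
by rewrite bi; apply/ffunP => j; rewrite !ffunE mulr0; exact: scaler0.
Qed.

End AmbientCoordinates.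

Section LocalForms.
Variables (F : fieldType) (r : nat).
Implicit Types X U : set 'rV[F]_r.+1.
Hypothesis char0 : [pchar F] =i pred0.

Lemma diff2_partial U (t : 'I_r -> reg U) f : is_basis (fun i => dif (t i)) ->
  \sum_i partial t f i *: diff2 (t i) - diff2 f \in diag_pow U 0 2.
Proof.
move=> ht; apply/dif_eqP.
- by rewrite rpred_sum// => i _; rewrite rpredZ ?diff2_ideal.
- exact: diff2_ideal.
rewrite cls_sum; last by move=> i _; rewrite rpredZ ?diff2_ideal.
rewrite -[RHS]/(dif f) (coord_sum ht (dif f)); apply: eq_bigr => i _.
by rewrite clsZ ?diff2_ideal.
Qed.

Lemma Taylor_change U (A B : VO U) (g' g : fun2 U) a (l : sect 1 U) :
  Taylor A = g' * pull2 (a *: l) -> Taylor B = g * pull2 l ->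
  g' - g \in diag_pow U 0 2 -> g \in @diag_ideal F r U ->
  Taylor (A - a *: B) \in diag_pow U 1 2.
Proof.
move=> AE BE gg gI; rewrite TaylorB TaylorZ AE BE.
have -> : g' * pull2 (a *: l) - a *: (g * pull2 l) =
    ((g' - g) * (pull2 (a : sect 0 U) : fun2 U) + g * diff2 a) * pull2 l.
  apply: fun2_ext => x y.
  rewrite -[LHS]/(g' (x, y) * (val a y * val l y) - val a x * (g (x, y) * val l y)).
  rewrite -[RHS]/(((g' (x, y) - g (x, y)) * val a y + g (x, y) * (val a y - val a x)) * val l y).
  by ring.
apply: (@diag_pow_twist _ _ _ 0 1); apply: rpredD.
  by apply: diag_pow_mulr => //; exact: pull2_mem.
by apply: (@diag_powM _ _ _ 0 1 1); apply: diag_ideal_pow1 => //; exact: diff2_ideal.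
Qed.

(* Both trivialisations represent the class of f(y) - f(x) in P^1(L) (x) L^*,
   so injectivity of alpha_1 on the ambient U forces agreement. *)
Lemma affine_dual_change U T t T' t' a (f : reg U) :
  proj_open U -> adapted T t -> adapted T' t' ->
  linform U (T' ord0) = a *: linform U (T ord0) ->
  affine_dual T' t' (partial t' f) = a *: affine_dual T t (partial t f).
Proof.
move=> hU hT hT' aE; apply/eqP; rewrite -subr_eq0; apply/eqP.
apply: (alpha1_inj hU hT); apply/alpha_eq0P.
have [_ _ tT ht] := hT; have [_ _ tT' ht'] := hT'.
have E' := Taylor_affine_dual (partial t' f) tT'; rewrite aE in E'.
apply: (Taylor_change E' (Taylor_affine_dual (partial t f) tT)).
  have subBB (u v w : fun2 U) : u - v = (u - w) - (v - w).
    by rewrite opprB addrA subrK.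
  by rewrite (subBB _ _ (diff2 f)); apply: rpredB; exact: diff2_partial.
by rewrite rpred_sum// => i _; rewrite rpredZ ?diff2_ideal.
Qed.

Variables (U X : set 'rV[F]_r.+1) (hXU : X `<=` U).
Hypothesis hU : proj_open U.

Lemma affine_dual_restrict T (t g : 'I_r -> reg U) j (x : X) :
  ev x (affine_dual T (fun i => restrict hXU (t i)) (fun i => restrict hXU (g i)) j : reg X)
  = ev (inclusion hXU x) (affine_dual T t g j : reg U).
Proof.
by rewrite /affine_dual !sum_ffunE !ev_sum; apply: eq_bigr => i _; rewrite !ffunE.
Qed.

Lemma conormal_inclE T t f j (x : X) : adapted T t -> f \in ideal_of hXU ->
  val (conormal_incl T t (conormal_cls hXU f) j) x =
  ev (inclusion hXU x) (affine_dual T t (partial t f) j : reg U) * val (t0dual X T) x.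
Proof.
move=> hT hf; rewrite ffunE (incl_t0E hT hf).
by rewrite -affine_dual_restrict.
Qed.

Lemma conormal_incl_change T t T' t' f : adapted T t -> adapted T' t' ->
  f \in ideal_of hXU ->
  conormal_incl T' t' (conormal_cls hXU f) = conormal_incl T t (conormal_cls hXU f).
Proof.
move=> hT hT' hf; have [_ gen _ _] := hT.
have [a [aE _]] := gen (linform U (T' ord0)).
have E := affine_dual_change f hU hT hT' aE.
have invK (e' e b d' d l' l : F) :
    e' = b * e -> d' * l' = 1 -> d * l = 1 -> l' = b * l -> e' * d' = e * d.
  move=> -> dl' dl lE; rewrite -[LHS]mulr1 -dl; move: dl'; rewrite lE => dl'.
  have -> : b * e * d' * (d * l) = d' * (b * l) * (e * d) by ring.
  by rewrite dl' mul1r.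
apply/ffunP => j; apply: val_inj; apply/funext => x.
rewrite (conormal_inclE j x hT hf) (conormal_inclE j x hT' hf).
apply: (invK _ _ (ev (inclusion hXU x) a) _ _ (val (linform X (T' ord0)) x)
  (val (linform X (T ord0)) x)).
- have := congr1 (fun w : VO U => ev (inclusion hXU x) (w j : reg U)) E.
  by rewrite ffunE.
- exact: (l0t0E (t0dualP hU hT' hXU)).
- exact: (l0t0E (t0dualP hU hT hXU)).
- exact: (congr1 (fun m : sect 1 U => val m (inclusion hXU x)) aE).
Qed.

Variables (n : nat) (s : 'I_n -> reg X).
Hypothesis hs : is_basis (fun i => dif (s i)).
Variables (T : 'I_r.+1 -> 'cV[F]_r.+1) (t : 'I_r -> reg U) (f : reg U).
Hypotheses (hT : adapted T t) (hf : f \in ideal_of hXU).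

Let fb := conormal_cls hXU f.
Let v : VO X := incl_t0 T t fb.
Let xi := conormal_incl T t fb.
Let t0 := linform X (T ord0).
Let l0t0 : pairing (t0dual X T) t0 = 1 := t0dualP hU hT hXU.

Lemma twist_conormal_incl : twist xi t0 = v.
Proof.
apply/ffunP => j; rewrite !ffunE; apply: reg_ext => y.
rewrite -[LHS]/(val (v j : reg X) y * val (t0dual X T) y * val t0 y).
by rewrite -mulrA (l0t0E l0t0) mulr1.
Qed.

Lemma conormal_incl_Rk k : xi \in @Rk F r X k <-> alpha k v = 0.
Proof.
split=> [/Rk_twist/(_ t0)|v0]; first by rewrite twist_conormal_incl.
by apply: mem_span; exists v, (t0dual X T).
Qed.

Let g : fun2 X := \sum_i restrict hXU (partial t f i) *: diff2 (restrict hXU (t i)).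

Let Taylor_v : Taylor v = g * pull2 t0.
Proof.
by rewrite /v (incl_t0E hT)// Taylor_affine_dual// => i; exact: linform_restrict.
Qed.

Lemma conormal_incl_R0 : xi \in @Rk F r X 0.
Proof.
apply/conormal_incl_Rk/alpha_eq0P; rewrite Taylor_v.
apply: (@diag_pow_twist _ _ _ 0 1); apply: diag_ideal_pow1.
by rewrite rpred_sum// => i _; rewrite rpredZ ?diff2_ideal.
Qed.

Lemma alpha_local_form k : (0 < k)%N -> alpha k.-1 v = 0 ->
  alpha k v = theta (local_form hXU k s t f) t0.
Proof.
move=> k0 /alpha_eq0P; rewrite prednK// Taylor_v => /(diag_pow_untwist l0t0) gk.
pose c i := restrict hXU (partial t f i).
pose u i := restrict hXU (t i).
pose D i (p : 'X_{1..n < k.+1}) : reg X := Dop s p (u i).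
pose b (p : 'X_{1..n < k.+1}) : reg X :=
  \sum_i c i * (D i p - if p == 0%MM :> 'X_{1..n} then u i else 0).
have gb : g - \sum_p b p *: monom s p \in diag_pow X 0 k.+1.
  have -> : \sum_p b p *: monom s p =
      \sum_i c i *: (\sum_p D i p *: monom s p - (pull1 (u i) : fun2 X)).
    under eq_bigr do rewrite scaler_suml; rewrite exchange_big.
    apply: eq_bigr => i _; under eq_bigr do rewrite -scalerA scalerBl.
    rewrite -scaler_sumr sumrB; congr (_ *: (_ - _)).
    rewrite (bigD1 (BMultinom (bm0_proof n k)))//= eqxx big1 ?addr0 => [|p].
      by rewrite monom0 fun2_scaleE mulr1.
    rewrite -val_eqE /= => /negPf ->; exact: scale0r.
  rewrite -sumrB rpred_sum// => i _; rewrite -scalerBr rpredZ//.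
  have -> : diff2 (u i) - (\sum_p D i p *: monom s p - (pull1 (u i) : fun2 X)) =
      (pull2 (u i : sect 0 X) : fun2 X) - \sum_p D i p *: monom s p.
    by rewrite opprB addrA subrK.
  exact: (Dop_taylor hs char0).
have bk : \sum_p b p *: monom s p \in diag_pow X 0 k.
  set h := \sum_p _ in gb *.
  have -> : h = (-1) *: (g - h) + g by rewrite scaleN1r opprB subrK.
  by rewrite rpredD ?rpredZ//; exact: diag_powSW.
have b0 := monom_free hs char0 bk.
have bE : \sum_p b p *: monom s p =
    \sum_(p : 'X_{1..n < k.+1} | mdeg p == k) b p *: monom s p.
  rewrite [RHS]big_mkcond; apply: eq_bigr => p _; case: ifP => // pk.
  by rewrite b0 ?scale0r// ltn_neqAle pk -ltnS bmdeg.
have -> : local_form hXU k s t f = \sum_(p : 'X_{1..n < k.+1} | mdeg p == k)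
    b p *: sym_monomial k (fun i => dif (s i)) p.
  rewrite /local_form; under eq_bigr do rewrite scaler_sumr.
  rewrite exchange_big; apply: eq_bigr => p /eqP pk.
  rewrite scaler_suml; apply: eq_bigr => i _; rewrite scalerA; congr (_ *: _).
  case: eqP => [p0|_]; last by rewrite subr0.
  by have : (0 < mdeg p)%N; [rewrite pk|rewrite p0 mdeg0].
rewrite theta_monomials -bE alphaE Taylor_v.
have mem (h : fun2 X) : h \in @pr2 F r X 0 -> h * pull2 t0 \in @pr2 F r X 1.
  by move=> hh; apply: (@pr2M _ _ _ 0 1) => //; exact: pull2_mem.
apply/PP_cls_eqP; [exact/mem/diag_pow_pr2/gk|exact/mem/diag_pow_pr2/bk|].
by rewrite -mulrBl; apply: (@diag_pow_twist _ _ _ 0 1).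
Qed.

Lemma fund_local_form k (h : xi \in @Rk F r X k.-1) : (0 < k)%N ->
  fund (in_Rk h) = local_form hXU k s t f.
Proof.
move=> k0; apply: (fund_unique hs l0t0 char0).
by rewrite /= twist_conormal_incl; apply: alpha_local_form => //; apply/conormal_incl_Rk.
Qed.

Lemma fund_vanishesP k : (0 < k)%N -> fund_vanishes k xi <-> alpha k v = 0.
Proof.
move=> k0; split=> [[h]|ak].
  have := fundE hs l0t0 char0 (in_Rk h) k0; rewrite /= twist_conormal_incl => -> ->.
  exact: theta0.
have h : xi \in @Rk F r X k.-1.
  apply/conormal_incl_Rk/alpha_eq0P; rewrite prednK//; apply: diag_powSW.
  exact/alpha_eq0P.
exists h; apply: (fund_unique hs l0t0 char0).
by rewrite /= twist_conormal_incl ak theta0.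
Qed.

End LocalForms.

Section FundamentalFormFiber.
Variables (F : fieldType) (r : nat) (X : set 'rV[F]_r.+1) (x : X).

Lemma fiber_clsP (M : lmodType (reg X)) a (u v : M) :
  fiber_cls x (a *: u + v) = ev x a *: fiber_cls x u + fiber_cls x v.
Proof.
rewrite -[ev x a *: _]/(cst_reg X (ev x a) *: (coset (@max_smul F r X x M) u)).
rewrite -[fiber_cls x v]/(coset (@max_smul F r X x M) v) -linearP.
apply/coset_eqP; rewrite opprD addrACA subrr addr0 -scalerBl.
apply: mem_span; exists (a - cst_reg X (ev x a)), u; split=> //.
exact: subrr.
Qed.

Lemma fiber_rep_semilinear (M : lmodType (reg X)) (Z : lmodType F) (psi : M -> Z) :
  (forall a u v, psi (a *: u + v) = ev x a *: psi u + psi v) ->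
  forall u, psi (fiber_rep (fiber_cls x u)) = psi u.
Proof.
move=> psiP u.
have psi0 : psi 0 = 0.
  have := psiP (-1) 0 0; rewrite scaler0 add0r => ->.
  by rewrite (_ : ev x (-1) = -1)// scaleN1r addNr.
have /coset_eqP : coset (@max_smul F r X x M) (fiber_rep (fiber_cls x u)) =
  coset (@max_smul F r X x M) u by exact: repK.
set w := fiber_rep _ => d.
suff H z : z \in @max_smul F r X x M -> psi z = 0.
  have -> : w = 1 *: (w - u) + u by rewrite scale1r subrK.
  by rewrite psiP H// scaler0 add0r.
move: z; apply: span_ind => [//|a z z' hz hz'|_ [a [z [a0 ->]]]].
- by rewrite psiP hz hz' scaler0 addr0.
- by rewrite -[a *: z]addr0 psiP a0 scale0r psi0 addr0.
Qed.

Variable k : nat.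

Let phi (w : {ffun 'I_k -> Omega X}) : Sym k (fiber x (Omega X)) :=
  symprod [ffun j => fiber_cls x (w j)].

Let phi_slot w j a (u v : Omega X) :
  phi (slot w j (a *: u + v)) = ev x a *: phi (slot w j u) + phi (slot w j v).
Proof.
have E z : [ffun i => fiber_cls x (slot w j z i)] =
    slot [ffun i => fiber_cls x (w i)] j (fiber_cls x z).
  by apply/ffunP => i; rewrite !ffunE; case: eqP.
by rewrite /phi !E fiber_clsP symprod_slot.
Qed.

Let phi_perm (w : {ffun 'I_k -> Omega X}) (s : 'S_k) : phi [ffun j => w (s j)] = phi w.
Proof.
rewrite /phi -[RHS](symprod_perm _ s); congr symprod.
by apply/ffunP => j; rewrite !ffunE.
Qed.

Definition fiber_lift (u : Sym k (Omega X)) : Sym k (fiber x (Omega X)) :=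
  sym_lift (@ev F r X x)
    (fun w : {ffun 'I_k -> Omega X} => symprod [ffun j => fiber_cls x (w j)]) u.

Let fiber_liftP a u v : fiber_lift (a *: u + v) = ev x a *: fiber_lift u + fiber_lift v.
Proof. exact: sym_liftP. Qed.

Let fiber_lift0 : fiber_lift 0 = 0.
Proof. exact: sym_lift0. Qed.

Let fiber_lift_sum (I : finType) (P : pred I) (c : I -> reg X) (f : I -> Sym k (Omega X)) :
  fiber_lift (\sum_(i | P i) c i *: f i) = \sum_(i | P i) ev x (c i) *: fiber_lift (f i).
Proof. by elim/big_rec2: _ => [|i y z _ <-]; [exact: fiber_lift0|exact: fiber_liftP]. Qed.

Lemma fiber_lift_monomial n (e : 'I_n -> Omega X) (p : 'X_{1..n}) : mdeg p = k ->
  fiber_lift (sym_monomial k e p) = sym_monomial k (fun j => fiber_cls x (e j)) p.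
Proof.
move=> pk; rewrite /fiber_lift sym_lift_symprod//; congr symprod; apply/ffunP => j.
rewrite !ffunE (map_comp (@fiber_cls F r X x _) e) (nth_map 0)//.
by rewrite size_map size_m2s pk.
Qed.

Variables (n : nat) (s : 'I_n -> reg X) (t0 : sect 1 X) (l0 : sect (-1) X).
Hypotheses (hs : is_basis (fun i => dif (s i))) (l0t0 : pairing l0 t0 = 1).
Hypotheses (char0 : [pchar F] =i pred0) (k0 : (0 < k)%N).

Lemma fund_at_cls (xi : submod (@Rk F r X k.-1)) :
  fund_at (fiber_cls x xi) = fiber_lift (fund xi).
Proof.
apply: (@fiber_rep_semilinear (submod (@Rk F r X k.-1)) _
  (fun u => fiber_lift (fund u))) => a u v.
exact: (etrans (congr1 fiber_lift (fundP hs l0t0 char0 a u v k0)) (fiber_liftP _ _ _)).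
Qed.

Lemma fiber_lift_local_form (U : set 'rV[F]_r.+1) (hXU : X `<=` U) (t : 'I_r -> reg U) f :
  fiber_lift (local_form hXU k s t f) = local_form_at hXU k s x t f.
Proof.
rewrite /local_form /local_form_at.
rewrite fiber_lift_sum.
apply: eq_bigr => i _.
congr (_ *: _).
rewrite fiber_lift_sum; apply: eq_bigr => p /eqP pk; congr (_ *: _).
exact: fiber_lift_monomial.
Qed.

End FundamentalFormFiber.

Theorem corollary2p11 (R : realType) (r n k : nat)
    (U X : set 'rV[R[i]]_r.+1) (hXU : X `<=` U) (x : X)
    (s : 'I_n -> reg X)
    (T : 'I_r.+1 -> 'cV[R[i]]_r.+1) (t : 'I_r -> reg U) :
  (1 <= n)%N -> (2 <= k)%N ->
  nonsingular_affine_variety X n ->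
  is_basis (fun i => dif (s i)) ->
  proj_open U -> affine_set U -> closed_in X U ->
  adapted T t ->
  forall (f : reg U), f \in ideal_of hXU ->
  let fb := conormal_cls hXU f in
  let xi := conormal_incl T t fb in
  [/\ [<-> xi \in Rk k.-1;
            alpha k.-1 (incl_t0 T t fb) = 0;
            forall j, (1 <= j <= k.-1)%N -> fund_vanishes j xi] /\
      (forall j, (1 <= j <= k.-1)%N ->
         (forall i, (1 <= i < j)%N -> fund_vanishes i xi) -> xi \in Rk j.-1),
      forall h : xi \in Rk k.-1,
        fund (in_Rk h) = local_form hXU k s t f /\
        (forall T' t', adapted T' t' ->
           local_form hXU k s t' f = local_form hXU k s t f)
    & forall h : xi \in Rk k.-1,
        fund_at (fiber_cls x (in_Rk h)) = local_form_at hXU k s x t f].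
Proof.
move=> _ k2 _ hs hU _ _ hT f hf fb xi.
have char0 : [pchar R[i]] =i pred0 by exact: Num.Theory.pchar_num.
have k0 : (0 < k)%N by exact: ltnW.
have k1 : (0 < k.-1)%N by rewrite -ltnS prednK.
have RkE := conormal_incl_Rk hXU hU f hT.
have vanE j : (0 < j)%N -> fund_vanishes j xi <-> alpha j (incl_t0 T t fb) = 0.
  by move=> j0; apply: (fund_vanishesP char0 hXU hU hs f hT j0).
have fundlE (h : xi \in Rk k.-1) : fund (in_Rk h) = local_form hXU k s t f.
  exact: (fund_local_form char0 hU hs hT hf).
split; first split.
- tfae.
  + exact: (RkE _).1.
  + move=> /alpha_eq0P ak j /andP[j0 jk]; apply/(vanE j j0)/alpha_eq0P.
    by apply: diag_pow_le ak.
  + by move=> van; apply/RkE/vanE => //; apply: van; rewrite k1 leqnn.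
- case=> // -[_ _|j _ van]; first exact: (conormal_incl_R0 hU hT hf).
  by apply/RkE/vanE => //; apply: van; rewrite leqnn.
- move=> h; split=> [|T' t' hT']; first exact: fundlE.
  have E := conormal_incl_change hU hT hT' hf.
  have h' : conormal_incl T' t' fb \in Rk k.-1 by rewrite E.
  apply: (etrans (esym (fund_local_form char0 hU hs hT' hf h' k0)) (etrans _ (fundlE h))).
  by congr fund; exact: val_inj.
- move=> h; rewrite (fund_at_cls x hs (t0dualP hU hT hXU) char0 k0) fundlE.
  exact: fiber_lift_local_form.
Qed.
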